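(* Let $k\ge 2$ be an integer. There exist constants $n_0\in\mathbb{N}$ and $C,c>0$ depending only on $k$ such that for all integers $n\ge n_0$, all $p\in[\frac1n,\frac12]$ and all $m\in g_{n,k}\mathbb{Z}$, $$\Bigl|\frac{\sigma}{g_{n,k}}\mathbf{P}(S=m)-\varphi\Bigl(\frac{m-\mu}{\sigma}\Bigr)\Bigr|\le C\Bigl((pn)^{-1/6}+\sigma\exp(-c\,pn)\Bigr).$$
   Context: For integers $k\ge2$, $n$, let $F_{n,k}(x)=\binom{n-1}{k}-\binom{x}{k}-\binom{n-x}{k}$, where $\binom{x}{k}=x(x-1)\cdots(x-k+1)/k!$ is regarded as a polynomial in $x$, and let $g_{n,k}=\gcd\{F_{n,k}(x):x\in\mathbb{Z}\}$. Let $(X_j)_{1\le j\le n-1}$ be independent Bernoulli random variables with parameter $p$, i.e. $\mathbf{P}(X_j=1)=p$, $\mathbf{P}(X_j=0)=1-p$, and let $S=\sum_{j=1}^{n-1}F_{n,k}(j)X_j$, $\mu=\mathbf{E}[S]$, $\sigma^2=\mathrm{Var}(S)$ with $\sigma>0$. Also $\varphi(x)=\frac{1}{\sqrt{2\pi}}e^{-x^2/2}$. *)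

(* Defs.v *)
From HB Require Import structures.
From mathcomp Require Import all_boot all_order all_algebra finmap.
From mathcomp Require Import all_classical all_reals all_analysis.

Set Implicit Arguments.
Unset Strict Implicit.
Unset Printing Implicit Defensive.

Import Order.TTheory GRing.Theory Num.Theory.
Import numFieldNormedType.Exports.

Local Open Scope classical_set_scope.
Local Open Scope ring_scope.

Definition binom_poly (k : nat) : {poly rat} :=
  (k`!%:R)^-1 *: \prod_(i < k) ('X - i%:R%:P).

Definition Fpoly (n : int) (k : nat) : {poly rat} :=
  (binom_poly k).[n%:~R - 1]%:P - binom_poly k
    - (binom_poly k \Po (n%:~R%:P - 'X)).

(* Restricting to integers [z] loses no value of F_{n,k}: see [Fpoly_int]. *)
Definition Fvalues (n : int) (k : nat) : set int :=
  [set z | exists x : int, z%:~R = (Fpoly n k).[x%:~R]].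

Definition is_gcd (A : set int) (g : int) : Prop :=
  [/\ 0 <= g,
      forall a, A a -> (g %| a)%Z &
      forall d : int, (forall a, A a -> (d %| a)%Z) -> (d %| g)%Z].

(* The default value 0 is irrelevant: every set of integers has a gcd, see
   [gcd_setP]. *)
Definition gcd_set (A : set int) : int := xget 0 (is_gcd A).

Definition gcdF (n : int) (k : nat) : int := gcd_set (Fvalues n k).

Lemma is_gcd_uniq (A : set int) (a b : int) : is_gcd A a -> is_gcd A b -> a = b.
Proof.
move=> [a0 aA aM] [b0 bA bM].
have ab : (a %| b)%Z by exact: bM.
have ba : (b %| a)%Z by exact: aM.
rewrite -(gez0_abs a0) -(gez0_abs b0); congr Posz.
by apply/eqP; rewrite eqn_dvd; apply/andP; split.
Qed.

Lemma gcd_setP (A : set int) : is_gcd A (gcd_set A).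
Proof.
apply: xgetPex.
case: (pselect (exists2 a, A a & a != 0)) => [[a0 Aa0 a0N0]|A0]; last first.
  exists 0; split=> // a Aa; have [->//|aN0] := eqVneq a 0.
  by exfalso; apply: A0; exists a.
pose cd (N : nat) := `[< forall a, A a -> (N%:Z %| a)%Z >].
have cd1 : exists N, cd N by exists 1%N; apply/asboolP => a _; exact: dvd1z.
have cd_le N : cd N -> (N <= `|a0|)%N.
  by move=> /asboolP/(_ _ Aa0) /dvdn_leq; apply; rewrite absz_gt0.
case: (ex_maxnP cd1 cd_le) => N /asboolP NA Nmax.
exists N%:Z; split=> // d dA.
have lcmA : cd (lcmn N `|d|).
  apply/asboolP => a Aa; rewrite dvdzE /= dvdn_lcm; apply/andP.
  by split; [exact: NA|exact: dA].
have N0 : (0 < lcmn N `|d|)%N.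
  move/asboolP: lcmA => /(_ _ Aa0); rewrite dvdzE /=; case: lcmn => //.
  by rewrite dvd0n absz_eq0 (negbTE a0N0).
have -> : N = lcmn N `|d|.
  by apply/eqP; rewrite eqn_leq Nmax// andbT dvdn_leq// dvdn_lcml.
by rewrite dvdzE /= dvdn_lcmr.
Qed.

Lemma binom_polyS k (x : rat) :
  (binom_poly k.+1).[x + 1] = (binom_poly k.+1).[x] + (binom_poly k).[x].
Proof.
have prodE m (y : rat) :
    (\prod_(i < m) ('X - i%:R%:P)).[y] = \prod_(i < m) (y - i%:R).
  by rewrite horner_prod; apply: eq_bigr => i _; rewrite !hornerE.
rewrite !hornerZ !prodE big_ord_recl /= subr0 [X in _ = _ * X + _]big_ord_recr /=.
have -> : \prod_(i < k) (x + 1 - (bump 0 i)%:R) = \prod_(i < k) (x - i%:R).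
  apply: eq_bigr => i _; rewrite /bump leq0n add1n -natr1.
  by rewrite [i%:R + 1]addrC opprD addrA addrK.
set p := \prod_(i < k) _.
have k0 : k`!%:R != 0 :> rat by rewrite pnatr_eq0 -lt0n fact_gt0.
have k1 : k.+1%:R != 0 :> rat by rewrite pnatr_eq0.
rewrite factS natrM invfM -natr1 in k1 *.
have -> : x + 1 = (x - k%:R) + (k%:R + 1) by rewrite addrA subrK.
rewrite mulrDl mulrDr [p * _]mulrC; congr (_ + _).
by rewrite mulrACA mulVf // mul1r.
Qed.

Lemma binom_poly_int k (x : int) : (binom_poly k).[x%:~R] \is a Num.int.
Proof.
elim: k x => [|k IHk] x.
  by rewrite /binom_poly big_ord0 fact0 invr1 scale1r hornerE.
have step (y : int) : ((binom_poly k.+1).[(y + 1)%:~R] \is a Num.int) =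
    ((binom_poly k.+1).[y%:~R] \is a Num.int).
  by rewrite intrD binom_polyS rpredDr.
elim/int_rec: x => [|m|m].
- rewrite /binom_poly hornerZ horner_prod big_ord_recl /=.
  by rewrite hornerD hornerX hornerN hornerC subrr mul0r mulr0.
- by rewrite intS addrC step.
- by rewrite -(step (- m.+1%:Z)) intS opprD addrAC addNr add0r.
Qed.

Lemma horner_Fpoly (n : int) k (x : rat) :
  (Fpoly n k).[x] =
  (binom_poly k).[n%:~R - 1] - (binom_poly k).[x] - (binom_poly k).[n%:~R - x].
Proof. by rewrite /Fpoly !(hornerD, hornerN, hornerC, horner_comp, hornerX). Qed.

Lemma Fpoly_int (n : int) k (x : int) : (Fpoly n k).[x%:~R] \is a Num.int.
Proof.
rewrite horner_Fpoly.
by rewrite -[1]/(1%:~R) -!intrB !rpredB ?binom_poly_int.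
Qed.

Definition mutually_independent d (T : measurableType d) (R : realType)
    (P : probability T R) (K : choiceType) (I : set K)
    (X : K -> {RV P >-> R}) : Prop :=
  forall J : {fset K}, [set` J] `<=` I ->
  forall A : K -> set R, (forall j, j \in J -> measurable (A j)) ->
  P (\bigcap_(j in [set` J]) (X j @^-1` A j)) =
  (\prod_(j <- J) P (X j @^-1` A j))%E.

Definition is_bernoulli d (T : measurableType d) (R : realType)
    (P : probability T R) (p : R) (X : {RV P >-> R}) : Prop :=
  P [set t | X t = 1] = p%:E /\ P [set t | X t = 0] = (1 - p)%:E.

Definition std_gauss (R : realType) (x : R) : R :=
  (Num.sqrt (2 * pi))^-1 * expR (- (x ^+ 2 / 2)).

(* Main.v *)
Require Import Defs.
From HB Require Import structures.
From mathcomp Require Import all_boot all_order all_algebra finmap.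
From mathcomp Require Import all_classical all_reals all_analysis.
From mathcomp Require Import measurable_realfun.
From mathcomp Require Import zify ring lra.

(** The sum S takes its values in g Z, where g = gcd of the values of F, so
    Fourier inversion writes (sigma / g) P(S = m) as 1 / (2 pi) times the integral
    over |t| <= pi sigma / g of the characteristic function of
    (S - m) / sigma ([bernE_inversion]).  Without the restriction on t, the same
    integral of exp (- t^2 / 2) cos (t z) gives the Gaussian density
    ([gauss_cos_le]).  It remains to compare the integrands.

    Only real integrals of cosines occur.  A mean over independent Bernoulli
    variables is defined by recursion on the list of weights ([bernE]), and for
    the mean of cos (theta S + be) two estimates, uniform in the phase be, follow
    by induction on the list: its square is at most
    exp (- 4 p (1 - p) sum_j sin^2 (theta F(j) / 2)) ([bernE_cos_sqr_le]), and it
    differs from its Gaussian counterpart by O(|theta|^3 p sum_j |F(j)|^3)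
    ([bernE_gauss]).

    Since F(j) = O(n^k) and sigma^2 has the order of p n^(2k+1), the second
    estimate reads O((p n)^(-1/2) |t|^3).  For |t| at most a constant times
    sigma / n^k, that is (p n)^(1/2), the first one gives a Gaussian decay; the
    geometric mean of both, with weights 1/3 and 2/3, is an integrable bound
    O((p n)^(-1/6) |t| exp (- t^2 / 6)) ([geometric_mean_bound]).

    For the other t the integrand is O(exp (- c p n)), and the length of the range
    of integration accounts for the factor sigma.  This rests on the arithmetic of
    F: if |al| <= 1 / (2 g) and the numbers al F(j) are close to integers
    on average, then al is as small as O(n^(-k)) ([key_estimate]).  To see
    this, let D be the degree of F and b its constant D-th difference.
    Differences with steps h_1, ..., h_D up to a small multiple of n show that
    h_1 ... h_D b al is close to an integer for all these steps, which forces b al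
    to be within O(n^(-D)) of an integer m.  Then al is within O(n^(-k)) of m / b,
    and (m / b) F(j) is close to an integer for D + 1 consecutive j.  As F / b has
    a denominator dividing 2 k!, these numbers are integers; hence so are all the
    numbers (m / b) F(x), and m / b is a multiple of 1 / g.  Being smaller than
    1 / g in absolute value, it vanishes. *)

Import Order.TTheory GRing.Theory Num.Theory.
Import numFieldNormedType.Exports.

Local Open Scope classical_set_scope.
Local Open Scope ring_scope.

Set Implicit Arguments.
Unset Strict Implicit.
Unset Printing Implicit Defensive.

(** * Finite differences *)

Definition fdiff {V : zmodType} (h : nat) (u : int -> V) (x : int) : V :=
  u (x + h%:Z) - u x.

Fixpoint fdiffs {V : zmodType} (hs : seq nat) (u : int -> V) : int -> V :=
  if hs is h :: hs' then fdiffs hs' (fdiff h u) else u.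

Lemma iter_fdiff_comm (D h : nat) (u : int -> int) (x : int) :
  iter D (fdiff 1) (fdiff h u) x = fdiff h (iter D (fdiff 1) u) x.
Proof.
elim: D x => [//|D IH] x.
rewrite iterS {1}/fdiff !IH iterS /fdiff (addrAC x).
set a := iter D _ u (x + _ + _); set b := iter D _ u (x + _).
set c := iter D _ u (x + _); set d := iter D _ u x; lia.
Qed.

Lemma fdiff_affine (w : int -> int) (b : int) (h : nat) (x : int) :
  (forall y, fdiff 1 w y = b) -> fdiff h w x = h%:Z * b.
Proof.
move=> wb; rewrite /fdiff; elim: h => [|h IH]; first by rewrite addr0 subrr mul0r.
have := wb (x + h%:Z); rewrite /fdiff -addrA -PoszD addn1.
move: (w (x + h.+1%:Z)) (w (x + h%:Z)) (w x) IH => A B C IH; lia.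
Qed.

(** A difference with step h is a sum of h unit differences, so that every step h
    multiplies the constant top difference by h. *)
Lemma fdiffs_const (hs : seq nat) (u : int -> int) (b : int) (x : int) :
  (forall y, iter (size hs) (fdiff 1) u y = b) ->
  fdiffs hs u x = (\prod_(h <- hs) h)%N%:Z * b.
Proof.
elim: hs u b => [|h hs IH] u b ub; first by rewrite big_nil -(ub x) /= mul1r.
rewrite [LHS]/= (IH _ (h%:Z * b)); first by rewrite big_cons; lia.
by move=> y; rewrite iter_fdiff_comm; apply: fdiff_affine => z; exact: ub.
Qed.

(** Over Z, a sequence with a constant D-th difference is determined by D + 1
    consecutive values: its difference sequence satisfies the hypotheses with
    D - 1 in place of D. *)
Lemma dvdz_of_window (D : nat) (u : int -> int) (b c x0 : int) :
  (forall y, iter D (fdiff 1) u y = b) ->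
  (forall i : nat, (i <= D)%N -> (c %| u (x0 + i%:Z))%Z) ->
  forall x, (c %| u x)%Z.
Proof.
elim: D u => [|D IH] u ub cu x.
  by have := cu 0%N isT; move: (ub x) (ub x0); rewrite /= addr0 => -> ->.
have cdu y : (c %| fdiff 1 u y)%Z.
  apply: IH => [z|i iD]; first by rewrite -iterSr ub.
  by rewrite /fdiff -addrA; apply: rpredB; [rewrite -PoszD addn1|]; apply: cu; lia.
have up (i : nat) z : (c %| u (z + i%:Z))%Z = (c %| u z)%Z.
  elim: i => [|i IHi]; first by rewrite addr0.
  rewrite -IHi -[in LHS](rpredBr _ (cdu (z + i%:Z))) /fdiff.
  by rewrite -addrA -PoszD addn1 subKr.
have cx0 : (c %| u x0)%Z by have := cu 0%N isT; rewrite addr0.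
have [xx0|/ltW xx0] := leP x0 x.
  have -> : x = x0 + `|x - x0|%N%:Z by lia.
  by rewrite up.
by rewrite -(up `|x0 - x|%N); have -> : x + `|x0 - x|%N%:Z = x0 by lia.
Qed.

(** Each difference costs a factor 4, because q (u (x + h) - u x) is bounded by
    2 q (u (x + h)) + 2 q (u x).  The function q will be the square, to bound the
    variance from below, and sin^2 (pi y), to measure the distance to the
    integers. *)
Lemma sum_fdiffs_le (R : realType) (V : zmodType) (q : V -> R) (hs : seq nat)
    (u : int -> V) (a b : nat) :
  (forall y, 0 <= q y) -> (forall y z, q (y - z) <= 2 * q y + 2 * q z) ->
  \sum_(a <= j < b) q (fdiffs hs u j%:Z) <=
    4 ^+ size hs * \sum_(a <= j < b + sumn hs) q (u j%:Z).
Proof.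
move=> q0 qB; elim: hs u => [|h hs IH] u; first by rewrite /= addn0 expr0 mul1r.
apply: le_trans (IH _) _; rewrite exprSr -mulrA ler_wpM2l ?exprn_ge0//=.
set B := (b + sumn hs)%N.
have -> : (b + (h + sumn hs) = B + h)%N by rewrite /B; lia.
have mono c d : (a <= c)%N -> (d <= B + h)%N ->
    \sum_(c <= j < d) q (u j%:Z) <= \sum_(a <= j < B + h) q (u j%:Z).
  move=> ac dB; have [cd|dc] := leqP c d; last first.
    by rewrite big_geq ?sumr_ge0// ltnW.
  rewrite (@big_cat_nat _ _ _ c a (B + h))//=; last by lia.
  rewrite (@big_cat_nat _ _ _ d c (B + h))//=.
  by rewrite addrCA lerDl addr_ge0// sumr_ge0.
apply: (@le_trans _ _ (2 * \sum_(a + h <= j < B + h) q (u j%:Z)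
                     + 2 * \sum_(a <= j < B) q (u j%:Z))).
  rewrite !big_distrr /= (big_addn a (B + h) h) addnK -big_split/= ler_sum// => j _.
  by rewrite /fdiff -PoszD; exact: qB.
have h1 := mono (a + h)%N (B + h)%N (leq_addr _ _) (leqnn _).
have h2 := mono a B (leqnn _) (leq_addr _ _).
lra.
Qed.

(** * Integer binomial polynomials *)

Definition binz (k : nat) (x : int) : int :=
  Num.floor (binom_poly k).[x%:~R].

Lemma binzE k x : (binz k x)%:~R = (binom_poly k).[x%:~R] :> rat.
Proof. by rewrite /binz floorK// binom_poly_int. Qed.

Lemma binz0 x : binz 0 x = 1.
Proof.
apply/eqP; rewrite -(eqr_int rat) binzE /binom_poly big_ord0 fact0 invr1 scale1r.
by rewrite hornerE.
Qed.

Lemma binzS k x : binz k.+1 (x + 1) = binz k.+1 x + binz k x.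
Proof.
by apply/eqP; rewrite -(eqr_int rat) intrD !binzE intrD binom_polyS.
Qed.

Lemma fact_binz k x : k`!%:Z * binz k x = \prod_(i < k) (x - i%:Z).
Proof.
apply/eqP; rewrite -(eqr_int rat) intrM binzE /binom_poly hornerZ horner_prod.
have k0 : k`!%:R != 0 :> rat by rewrite pnatr_eq0 -lt0n fact_gt0.
rewrite -pmulrn mulVKf// rmorph_prod; apply/eqP/eq_bigr => i _ /=.
by rewrite !hornerE intrB.
Qed.

Lemma binz1 x : binz 1 x = x.
Proof. by have := fact_binz 1 x; rewrite big_ord1 mul1r subr0. Qed.

Lemma binz_bound k (n : nat) (x : int) : (k <= n)%N -> 0 <= x <= n%:Z ->
  `|binz k x| <= n%:Z ^+ k.
Proof.
move=> kn /andP[x0 xn].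
have kf : 1 <= k`!%:Z :> int by have := fact_gt0 k; lia.
apply: (@le_trans _ _ (k`!%:Z * `|binz k x|)).
  by rewrite ler_peMl.
rewrite -[X in X * _]gtr0_norm ?(lt_le_trans _ kf)// -normrM fact_binz normr_prod.
rewrite -[X in _ <= _ ^+ X]card_ord -prodr_const ler_prod// => i _.
by have := ltn_ord i; rewrite normr_ge0; lia.
Qed.

Definition Fint (n : int) (k : nat) (x : int) : int :=
  binz k (n - 1) - binz k x - binz k (n - x).

Lemma FintE n k x : (Fint n k x)%:~R = (Fpoly n k).[x%:~R] :> rat.
Proof. by rewrite horner_Fpoly /Fint !intrB !binzE !intrB. Qed.

Lemma is_gcd_Fint n k :
  (forall x, (gcdF n k %| Fint n k x)%Z) /\
  (forall d, (forall x, (d %| Fint n k x)%Z) -> (d %| gcdF n k)%Z) /\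
  0 <= gcdF n k.
Proof.
have [g0 gd dg] := gcd_setP (Fvalues n k); split; [|split => //].
  by move=> x; apply: gd; exists x; rewrite FintE.
move=> d dF; apply: dg => z [x]; rewrite -FintE => /eqP; rewrite eqr_int => /eqP ->.
exact: dF.
Qed.

Lemma Fint_bound n k (x : int) : (0 < k <= n)%N -> 0 <= x <= n%:Z ->
  `|Fint n%:Z k x| <= 3 * n%:Z ^+ k.
Proof.
move=> /andP[k0 kn] xn.
have h1 := @binz_bound k n x kn xn.
have h2 := @binz_bound k n (n%:Z - x) kn ltac:(lia).
have h3 := @binz_bound k n (n%:Z - 1) kn ltac:(lia).
by rewrite /Fint; lia.
Qed.

(** For odd k the terms of degree k cancel: F then has degree k - 1, and its top
    difference has the order of n instead of being bounded. *)
Definition Fdeg (k : nat) : nat := if odd k then k.-1 else k.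
Definition Ftop (n k : nat) : int := if odd k then - (n%:Z - k%:Z + 1) else - 2.

(** By Pascal's rule, a difference lowers the lower index of each binomial
    coefficient by one; the one in n - x also changes its sign. *)
Lemma iter_fdiff_Fint (n : int) (k i : nat) (x : int) : (0 < i <= k)%N ->
  iter i (fdiff 1) (Fint n k) x =
  - binz (k - i) x - (- 1) ^+ i * binz (k - i) (n - x - i%:Z).
Proof.
case: i => // i /=; elim: i x => [|i IH] x ik.
  rewrite /= /fdiff /Fint; have [k' ->] : exists k', k = k'.+1 by exists k.-1; lia.
  rewrite binzS subn1 /= expr1.
  rewrite -[1%:Z]/(1 : int).
  have -> : n - x = n - (x + 1) + 1 by lia.
  rewrite binzS; have -> : n - (x + 1) + 1 - 1 = n - (x + 1) by lia.
  by lia.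
rewrite iterS {1}/fdiff !IH; try lia.
have [k' kE] : exists k', (k - i.+1 = k'.+1)%N by exists (k - i.+2)%N; lia.
rewrite kE; have -> : (k - i.+2 = k')%N by lia.
have -> : n - x - i.+1%:Z = n - (x + 1) - i.+1%:Z + 1 by lia.
rewrite !binzS [(-1) ^+ i.+2]exprS.
have -> : n - (x + 1) - i.+1%:Z = n - x - i.+2%:Z by lia.
by ring.
Qed.

Lemma iter_fdiff_Ftop (n k : nat) (x : int) : (2 <= k)%N ->
  iter (Fdeg k) (fdiff 1) (Fint n%:Z k) x = Ftop n k.
Proof.
move=> k2; rewrite /Fdeg /Ftop; case: ifP => ok; rewrite iter_fdiff_Fint; try lia.
  have -> : (k - k.-1 = 1)%N by lia.
  rewrite !binz1 -signr_odd; have -> : odd k.-1 = false by lia.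
  by rewrite expr0; lia.
by rewrite subnn !binz0 -signr_odd ok expr0; lia.
Qed.

(** This bounds the denominator of F / Ftop.  For odd k, let b = n - k + 1, so that
    n = k - 1 modulo b: the product for binom(n - 1, k) contains the factor
    n - 1 - (k - 2) = b, and the one for binom(n - x, k) is congruent to the
    opposite of the one for binom(x, k). *)
Lemma Ftop_dvd (n k : nat) (x : int) : (2 <= k)%N ->
  (Ftop n k %| 2 * k`!%:Z * Fint n%:Z k x)%Z.
Proof.
have dvdNz d m : (- d %| m)%Z = (d %| m)%Z by rewrite !dvdzE abszN.
move=> k2; rewrite /Ftop; case: ifP => ok; last first.
  by rewrite dvdNz -mulrA dvdz_mulr.
rewrite dvdNz -mulrA dvdz_mull// /Fint !mulrBr !fact_binz.
set b := n%:Z - k%:Z + 1.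
have kk : (k - 2 < k)%N by lia.
rewrite (bigD1 (Ordinal kk))//=.
have -> : n%:Z - 1 - (k - 2)%N%:Z = b by rewrite /b; lia.
rewrite -addrA -opprD rpredB//; first exact: dvdz_mulr.
have cong (f g : 'I_k -> int) : (forall i, (b %| f i - g i)%Z) ->
    (b %| \prod_i f i - \prod_i g i)%Z.
  move=> fg; elim/big_rec2: _ => [|i y z _ IH]; first by rewrite subrr dvdz0.
  have -> : f i * z - g i * y = f i * (z - y) + (f i - g i) * y by ring.
  by apply: rpredD; [exact: dvdz_mull|exact: dvdz_mulr].
have -> : \prod_(i < k) (x - i%:Z) = - \prod_(i < k) ((k%:Z - 1 - x) - i%:Z).
  rewrite [in RHS](reindex_inj rev_ord_inj) /=.
  rewrite [in RHS](eq_bigr (fun i : 'I_k => - (x - i%:Z))).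
    by rewrite prodrN card_ord -signr_odd ok expr1 mulN1r opprK.
  by move=> i _; have := ltn_ord i; lia.
rewrite addrC; apply: cong => i.
by have -> : n%:Z - x - i%:Z - (k%:Z - 1 - x - i%:Z) = b by rewrite /b; lia.
Qed.

(** * Elementary inequalities *)

Section Elementary.
Context {R : realType}.
Implicit Types x y : R.

Lemma ge0_of_is_derive (f df : R -> R) :
  (forall x, is_derive x 1 f (df x)) -> f 0 = 0 -> (forall x, 0 <= x -> 0 <= df x) ->
  forall x, 0 <= x -> 0 <= f x.
Proof.
move=> fD f0 df0 x x0.
have fc : {within `[0, x], continuous f}.
  by apply: derivable_within_continuous => y _; have [] := fD y.
have [c] := MVT_segment x0 (fun y _ => fD y) fc.
rewrite in_itv /= f0 !subr0 => /andP[c0 _] ->.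
by rewrite mulr_ge0// df0.
Qed.

Lemma sin_le_id x : 0 <= x -> sin x <= x.
Proof.
move=> x0; rewrite -subr_ge0; move: x x0.
apply: (@ge0_of_is_derive (fun x => x - sin x) (fun x => 1 - cos x)).
- by rewrite sin0 subrr.
- by move=> x _; rewrite subr_ge0 cos_le1.
Qed.

Lemma cos_ge_quad x : 1 - x ^+ 2 / 2 <= cos x.
Proof.
suff H y : 0 <= y -> 0 <= cos y - 1 + y ^+ 2 / 2.
  have := H `|x| (normr_ge0 _); rewrite cos_norm real_normK ?num_real//; lra.
apply: (@ge0_of_is_derive (fun x => cos x - 1 + x ^+ 2 / 2) (fun x => - sin x + x)).
- move=> z; apply: is_derive_eq; rewrite /GRing.scale/=; lra.
- by rewrite cos0; lra.
- by move=> z z0; have := sin_le_id z0; lra.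
Qed.

Lemma sin_ge_cubic x : 0 <= x -> x - x ^+ 3 / 6 <= sin x.
Proof.
move=> x0; suff : 0 <= sin x - x + x ^+ 3 / 6 by lra.
move: x x0.
apply: (@ge0_of_is_derive (fun x => sin x - x + x ^+ 3 / 6)
  (fun x => cos x - 1 + x ^+ 2 / 2)).
- move=> z; apply: is_derive_eq; rewrite /GRing.scale/=; lra.
- by rewrite sin0; lra.
- by move=> z z0; have := cos_ge_quad z; lra.
Qed.

Lemma cos_le_cubic x : `|cos x - 1 + x ^+ 2 / 2| <= `|x| ^+ 3 / 6.
Proof.
rewrite ger0_norm; last by have := cos_ge_quad x; lra.
have H1 y : 0 <= y -> 1 - cos y <= y.
  move=> y0; suff : 0 <= y - 1 + cos y by lra.
  move: y y0.
  apply: (@ge0_of_is_derive (fun y => y - 1 + cos y) (fun y => 1 - sin y)).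
  - move=> z; apply: is_derive_eq; lra.
  - by rewrite cos0; lra.
  - by move=> z _; have := sin_le1 z; lra.
have H2 y : 0 <= y -> y - sin y <= y ^+ 2 / 2.
  move=> y0; suff : 0 <= y ^+ 2 / 2 - y + sin y by lra.
  move: y y0.
  apply: (@ge0_of_is_derive (fun y => y ^+ 2 / 2 - y + sin y) (fun y => y - 1 + cos y)).
  - move=> z; apply: is_derive_eq; rewrite /GRing.scale/=; lra.
  - by rewrite sin0; lra.
  - by move=> z /H1; lra.
suff H y : 0 <= y -> 0 <= 1 - y ^+ 2 / 2 + y ^+ 3 / 6 - cos y.
  have := H `|x| (normr_ge0 _); rewrite cos_norm real_normK ?num_real//; lra.
apply: (@ge0_of_is_derive (fun y => 1 - y ^+ 2 / 2 + y ^+ 3 / 6 - cos y)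
  (fun y => y ^+ 2 / 2 - y + sin y)).
- move=> z; apply: is_derive_eq; rewrite /GRing.scale/=; lra.
- by rewrite cos0; lra.
- by move=> z /H2; lra.
Qed.

Lemma sin_le_cubic x : `|sin x - x| <= `|x| ^+ 3 / 6.
Proof.
have H y : 0 <= y -> `|sin y - y| <= y ^+ 3 / 6.
  by move=> y0; have := sin_ge_cubic y0; have := sin_le_id y0; rewrite ler_norml; lra.
have [x0|x0] := leP 0 x; first by rewrite (ger0_norm x0) H.
have := H (- x); rewrite oppr_ge0 ltW// => /(_ isT).
by rewrite sinN -opprD normrN (ltr0_norm x0).
Qed.

Lemma expRN_le_quad y : 0 <= y -> `|expR (- y) - 1 + y| <= y ^+ 2 / 2.
Proof.
move=> y0; have h1 (z : R) : 1 - z <= expR (- z) by have := expR_ge1Dx (- z); lra.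
rewrite ger0_norm; last by have := h1 y; lra.
suff : 0 <= 1 - y + y ^+ 2 / 2 - expR (- y) by lra.
move: y y0.
apply: (@ge0_of_is_derive (fun y => 1 - y + y ^+ 2 / 2 - expR (- y))
  (fun y => - 1 + y + expR (- y))).
- move=> z; apply: is_derive_eq; rewrite /GRing.scale/=; lra.
- by rewrite oppr0 expR0; lra.
- by move=> z _; have := h1 z; lra.
Qed.

Lemma sin_pi_sqrD (m : int) y : sin (pi * (y + m%:~R)) ^+ 2 = sin (pi * y) ^+ 2.
Proof.
have step (z : R) : sin (pi * (z + 1)) ^+ 2 = sin (pi * z) ^+ 2.
  by rewrite mulrDr mulr1 sinDpi sqrrN.
elim/int_rec: m => [|m|m]; first by rewrite addr0.
- by move=> <-; rewrite -[RHS]step intS [1 + _]addrC rmorphD /= addrA.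
- move=> <-; rewrite -[LHS]step; congr (sin (pi * _) ^+ 2).
  by rewrite -addrA; congr (_ + _); rewrite -[1 in LHS]/(1%:~R) -intrD; congr (_%:~R); lia.
Qed.

Lemma sin_pi_int (m : int) : sin (pi * m%:~R) = 0 :> R.
Proof.
have := sin_pi_sqrD m 0; rewrite add0r mulr0 sin0 expr0n /= => /eqP.
by rewrite sqrf_eq0 => /eqP.
Qed.

End Elementary.

(** * Approximate integrality *)

Section NearInt.
Context {R : realType}.
Implicit Types (e y b : R).

(** Asking for some close integer, instead of bounding the distance to the
    nearest one, makes the triangle inequality immediate. *)
Definition near_int e y := exists m : int, `|y - m%:~R| <= e.

(** If r is the distance from y to the nearest integer, then v = pi r is at most
    pi / 2 < 2, where sin v >= v - v^3 / 6 >= v / 3. *)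
Lemma near_int_sin e y : 0 <= e -> sin (pi * y) ^+ 2 <= e ^+ 2 -> near_int (2 * e) y.
Proof.
move=> e0 se; pose m := Num.floor (y + 2^-1); exists m.
have := floor_itv (y + 2^-1); rewrite -/m intrD /= => /andP[my ym].
set r := y - m%:~R; have rh : `|r| <= 2^-1 by rewrite ler_norml /r; lra.
have sr : sin (pi * r) ^+ 2 <= e ^+ 2.
  by rewrite -(sin_pi_sqrD m) /r subrK.
have p2 := pi_ge2 R; have p4 := pihalf_lt2 R.
pose v := pi * `|r|; have v0 : 0 <= v by rewrite mulr_ge0 ?pi_ge0.
have v2 : v <= 2 by rewrite /v; nra.
have sv : sin v ^+ 2 = sin (pi * r) ^+ 2.
  rewrite /v; have [|] := leP 0 r; first by move=> r0; rewrite ger0_norm.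
  by move=> r0; rewrite ltr0_norm// mulrN sinN sqrrN.
have sv3 : v / 3 <= sin v.
  apply: le_trans (sin_ge_cubic v0); have : 0 <= v * (4 - v ^+ 2).
    by rewrite mulr_ge0//; nra.
  rewrite [v ^+ 3]exprS; lra.
have sve : sin v <= e.
  rewrite -(@ler_pXn2r _ 2%N) ?nnegrE//; last by lra.
  by rewrite sv.
rewrite /v in sv3 v0; nra.
Qed.

(** Let r be the offset of b from an integer.  By induction h |r| <= e: indeed
    (h + 1) |r| <= 2 e, while (h + 1) r is within e of an integer, which can only
    be 0 because 3 e < 1. *)
Lemma near_int_div (H : nat) e b : (0 < H)%N -> 3 * e < 1 ->
  (forall h : nat, (0 < h <= H)%N -> near_int e (h%:R * b)) ->
  near_int (e / H%:R) b.
Proof.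
move=> H0 e3 nb; have [m] := nb 1%N H0.
rewrite mul1r; set r := b - m%:~R => re; exists m; rewrite -/r.
have e0 : 0 <= e by exact: le_trans re.
suff hr (h : nat) : (0 < h <= H)%N -> h%:R * `|r| <= e.
  by rewrite ler_pdivlMr ?ltr0n// mulrC; apply: hr; rewrite H0 /=.
elim: h => // h IH /andP[_ hH]; have [->|h0] := posnP h; first by rewrite mul1r.
have {}IH := IH ltac:(lia).
have [m' m'e] := nb h.+1 ltac:(lia).
have r2e : h.+1%:R * `|r| <= 2 * e by rewrite -natr1; lra.
(* the integer found near (h+1) r is within 3e < 1 of 0 *)
have : `|(h.+1%:Z * m - m')%:~R| < 1 :> R.
  have -> : (h.+1%:Z * m - m')%:~R = (h.+1%:R * b - m'%:~R) - h.+1%:R * r :> R.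
    by rewrite intrB intrM /r -pmulrn; ring.
  apply: le_lt_trans (ler_normB _ _) _.
  by rewrite (normrM _ r) (ger0_norm (ler0n R h.+1)); lra.
rewrite -intr_norm ltrz1 => m0.
have mE : h.+1%:Z * m - m' = 0 by lia.
have : h.+1%:R * b - m'%:~R = h.+1%:R * r.
  have : (h.+1%:Z * m - m')%:~R = 0 :> R by rewrite mE.
  by rewrite intrB intrM -pmulrn /r; lra.
by move=> E; move: m'e; rewrite E normrM ger0_norm.
Qed.

(** Free one factor of the product at a time. *)
Lemma near_int_prod_div (H D : nat) e b : (0 < H)%N -> 3 * e < 1 ->
  (forall hs : seq nat, size hs = D -> all (fun h => 0 < h <= H)%N hs ->
     near_int e ((\prod_(h <- hs) h)%N%:R * b)) ->
  near_int (e / H%:R ^+ D) b.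
Proof.
move=> H0; elim: D e => [|D IH] e e3 nb.
  by have := nb [::] erefl isT; rewrite big_nil mul1r divr1.
have eH : near_int (e / H%:R) ((\prod_(h <- nseq D 1%N) h)%N%:R * b).
  apply: near_int_div => // h hH.
  have := nb (h :: nseq D 1%N) _ _; rewrite /= size_nseq hH all_nseq /= H0 orbT.
  by move=> /(_ erefl isT); rewrite big_cons natrM mulrA.
have e0 : 0 <= e.
  by have [m] := nb (nseq D.+1 1%N) (size_nseq _ _) ltac:(by rewrite all_nseq/= H0); exact: le_trans.
have H1 : 1 <= H%:R :> R by rewrite ler1n.
have ele : e / H%:R <= e by rewrite ler_pdivrMr ?ltr0n// ler_peMr.
rewrite exprS invfM mulrA; apply: IH; first by lra.
move=> hs hsD hsH; apply: near_int_div => // h hH.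
by have := nb (h :: hs); rewrite /= hsD hH hsH big_cons natrM mulrA; apply.
Qed.

End NearInt.

(** * Exponential sums along F *)

Lemma iter_fdiff_scale (D : nat) (c : int) (u : int -> int) (x : int) :
  iter D (fdiff 1) (fun y => c * u y) x = c * iter D (fdiff 1) u x.
Proof. by elim: D x => // D IH x; rewrite !iterS {1}/fdiff !IH -mulrBr. Qed.

Lemma dvdz_iter_fdiff (D : nat) (c : int) (u : int -> int) (x : int) :
  (forall y, (c %| u y)%Z) -> (c %| iter D (fdiff 1) u x)%Z.
Proof.
move=> cu; elim: D x => // D IH x; rewrite iterS /fdiff.
by apply: rpredB; exact: IH.
Qed.

(** The quotient b / gcd(b, m) divides every F(x), hence the gcd of these
    values. *)
Lemma dvdz_mul_gcdF (n : int) (k : nat) (b m : int) : b != 0 ->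
  (forall x, (b %| m * Fint n k x)%Z) -> (b %| m * gcdF n k)%Z.
Proof.
move=> b0 bF; pose c := gcdz b m.
have c0 : c != 0 by rewrite gcdz_eq0 (negbTE b0).
have /dvdzP[b1 b1E] : (c %| b)%Z by exact: dvdz_gcdl.
have /dvdzP[m1 m1E] : (c %| m)%Z by exact: dvdz_gcdr.
have b1m1 : coprimez b1 m1.
  have cE : c = `|c|%N%:Z by [].
  by rewrite /coprimez -(inj_eq (mulIf c0)) mul1r {1}cE mulz_gcdl -b1E -m1E.
have [_ [dg _]] := is_gcd_Fint n k.
rewrite b1E m1E mulrAC dvdz_mul2r// dvdz_mull// dg// => x.
rewrite -(Gauss_dvdzr _ b1m1) -(@dvdz_mul2r c)//.
by rewrite mulrAC -b1E -m1E.
Qed.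

(** The gcd of the values divides every difference of F, in particular Ftop. *)
Lemma gcdF_le (n k : nat) : (2 <= k)%N -> (2 * k <= n)%N ->
  0 < gcdF n%:Z k <= n%:Z.
Proof.
move=> k2 kn; have [gF [_ g0]] := is_gcd_Fint n%:Z k.
have gb : (gcdF n%:Z k %| Ftop n k)%Z.
  by rewrite -(iter_fdiff_Ftop n 0 k2); exact: dvdz_iter_fdiff.
have b0 : Ftop n k != 0 by rewrite /Ftop; case: ifP; lia.
have bn : `|Ftop n k| <= n%:Z by rewrite /Ftop; case: ifP; lia.
have gn0 : gcdF n%:Z k != 0.
  by apply: contraNneq b0 => gE; move: gb; rewrite gE dvd0z.
rewrite lt_neqAle eq_sym gn0 g0 /=.
move: gb; rewrite dvdzE => /dvdn_leq; rewrite absz_gt0 b0 => /(_ isT); lia.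
Qed.

Section KeyEstimate.
Context {R : realType}.

(** This vanishes exactly at the integers, is subadditive up to a factor 2, and
    governs the characteristic function of a Bernoulli variable. *)
Definition sqsin (y : R) := sin (pi * y) ^+ 2.

Lemma sqsin_ge0 y : 0 <= sqsin y. Proof. exact: sqr_ge0. Qed.

Lemma sqsinB y z : sqsin (y - z) <= 2 * sqsin y + 2 * sqsin z.
Proof.
rewrite /sqsin mulrBr sinB; set a := sin _; set b := cos _; set c := cos _.
set d := sin (pi * z).
have b1 : b ^+ 2 <= 1 by rewrite cos2sin2 gerBl sqr_ge0.
have c1 : c ^+ 2 <= 1 by rewrite cos2sin2 gerBl sqr_ge0.
have h1 : a ^+ 2 * b ^+ 2 <= a ^+ 2 by rewrite ler_piMr ?sqr_ge0.
have h2 : c ^+ 2 * d ^+ 2 <= d ^+ 2 by rewrite ler_piMl ?sqr_ge0.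
have h3 := sqr_ge0 (a * b + c * d); nra.
Qed.

Lemma fdiffs_scale (hs : seq nat) (al : R) (u : int -> int) (x : int) :
  fdiffs hs (fun y => al * (u y)%:~R) x = al * (fdiffs hs u x)%:~R.
Proof.
elim: hs u => //= h hs IH u; rewrite -IH; congr (fdiffs _ _ _).
by apply/funext => y; rewrite /fdiff intrB mulrBr.
Qed.

Variable k : nat.
Hypothesis k2 : (2 <= k)%N.

Section FixedN.
Variable n : nat.
Hypothesis n8k : (8 * k <= n)%N.

Let D := Fdeg k.
Let b := Ftop n k.
(* D steps up to H from a point up to M + 1 stay below n *)
Let H := (n %/ (4 * k))%N.
Let M := (n./2)%N.

Let Dk : (D <= k)%N. Proof. by rewrite /D /Fdeg; case: ifP; lia. Qed.
Let n0 : 0 < n%:R :> R. Proof. by rewrite ltr0n; lia. Qed.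

Let H_lb : (n <= 8 * k * H)%N.
Proof.
rewrite /H; have := divn_eq n (4 * k); have : (n %% (4 * k) < 4 * k)%N.
  by rewrite ltn_mod; lia.
have : (2 <= n %/ (4 * k))%N by rewrite leq_divRL; lia.
set q := (n %/ _)%N; set r := (n %% _)%N; nia.
Qed.

Let H_gt0 : (0 < H)%N. Proof. by move: H_lb; case: H => //; lia. Qed.
Let H_ub : (4 * (k * H) <= n)%N.
Proof. by have := leq_trunc_div n (4 * k); rewrite /H; lia. Qed.

Let M_lb : n%:R <= 4 * M%:R :> R.
Proof. by rewrite -natrM ler_nat /M; lia. Qed.

Let M_gt0 : (0 < M)%N. Proof. by rewrite /M; lia. Qed.
Let MDn : (M.+1 + D < n)%N. Proof. by move: Dk; rewrite /M; lia. Qed.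

Let nkD_le : n%:R ^+ k <= 2 * `|b|%:~R * n%:R ^+ D :> R.
Proof.
rewrite /b /D /Ftop /Fdeg; case: ifP => ok; last first.
  by rewrite normrN ler_peMl ?exprn_ge0// -[2]/(2%:~R) -intrM -[1]/(1%:~R) ler_int.
rewrite -[in X in X <= _](@prednK k) ?exprS; last by lia.
rewrite ler_wpM2r ?exprn_ge0// ?ler0n// -[2]/(2%:~R) -intrM.
by rewrite -[n%:R]/(n%:Z%:~R) ler_int; lia.
Qed.

Let nD_le : n%:R ^+ D <= (8 * k)%:R ^+ k * H%:R ^+ D :> R.
Proof.
apply: (@le_trans _ _ ((8 * k)%:R ^+ D * H%:R ^+ D)).
  rewrite -exprMn -natrM; have [->|D0] := posnP D; first by rewrite !expr0.
  by rewrite ler_pXn2r ?nnegrE ?ler0n// ler_nat.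
rewrite ler_wpM2r ?exprn_ge0// ler_weXn2l// ler1n; lia.
Qed.

Let sumn_le (hs : seq nat) : size hs = D -> all (fun h => 0 < h <= H)%N hs ->
  (sumn hs <= k * H)%N.
Proof.
move=> hsD /allP hsH; apply: (@leq_trans (D * H)); last by rewrite leq_mul2r Dk orbT.
rewrite -hsD; elim: hs {hsD} hsH => //= h hs IH hH; rewrite mulSn leq_add//.
  by have /andP[] := hH h (mem_head _ _).
by apply: IH => x xhs; apply: hH; rewrite in_cons xhs orbT.
Qed.

(** A D-fold difference of F is a constant, so that a small average of q over
    the values of F makes q small at that constant. *)
Lemma top_difference_le (q : R -> R) (al : R) (hs : seq nat) :
  (forall y, 0 <= q y) -> (forall y z, q (y - z) <= 2 * q y + 2 * q z) ->
  size hs = D -> all (fun h => 0 < h <= H)%N hs ->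
  n%:R * q (al * ((\prod_(h <- hs) h)%N%:Z * b)%:~R) <=
    4 ^+ k.+1 * \sum_(1 <= j < n) q (al * (Fint n%:Z k j%:Z)%:~R).
Proof.
move=> q0 qB hsD hsH.
have := sum_fdiffs_le hs (fun x => al * (Fint n%:Z k x)%:~R) 1 M.+1 q0 qB.
have Fc j : fdiffs hs (Fint n%:Z k) j = (\prod_(h <- hs) h)%N%:Z * b.
  by apply: fdiffs_const => y; rewrite hsD iter_fdiff_Ftop.
have -> : \sum_(1 <= j < M.+1)
    q (fdiffs hs (fun x => al * (Fint n%:Z k x)%:~R) j%:Z) =
    \sum_(1 <= j < M.+1) q (al * ((\prod_(h <- hs) h)%N%:Z * b)%:~R).
  by apply: eq_bigr => j _; rewrite fdiffs_scale Fc.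
rewrite sumr_const_nat subn1 /= hsD => h1.
have Mn : (M.+1 + sumn hs <= n)%N.
  by have := sumn_le hsD hsH; move: H_ub n8k k2; rewrite /M; nia.
have h2 : \sum_(1 <= j < M.+1 + sumn hs) q (al * (Fint n%:Z k j%:Z)%:~R) <=
    \sum_(1 <= j < n) q (al * (Fint n%:Z k j%:Z)%:~R).
  rewrite [leRHS](@big_cat_nat _ _ _ (M.+1 + sumn hs)%N)//=.
  by rewrite lerDl sumr_ge0.
set Q := \sum_(1 <= j < n) _ in h2 *; set c := q _ in h1 *; rewrite -[c *+ _]mulr_natl in h1.
have h3 : M%:R * c <= 4 ^+ k * Q.
  apply: (le_trans h1); apply: ler_pM => //.
    by rewrite sumr_ge0.
  by rewrite ler_weXn2l// ler1n.
have c0 : 0 <= c by exact: q0.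
by have := ler_wpM2r c0 M_lb; rewrite [4 ^+ k.+1]exprS; lra.
Qed.

(** With all steps equal to H the top difference of F has the order of n^k. *)
Lemma sum_Fint_sqr_lb :
  n%:R ^+ (2 * k).+1 <=
    4 ^+ k.+2 * (8 * k)%:R ^+ (2 * k) *
    \sum_(1 <= j < n) (Fint n%:Z k j%:Z)%:~R ^+ 2 :> R.
Proof.
have sqB (y z : R) : (y - z) ^+ 2 <= 2 * y ^+ 2 + 2 * z ^+ 2.
  by have := sqr_ge0 (y + z); lra.
have := @top_difference_le (fun y => y ^+ 2) 1 (nseq D H) (fun y => sqr_ge0 y) sqB.
rewrite size_nseq all_nseq H_gt0 leqnn orbT => /(_ erefl isT).
have -> : (\prod_(h <- nseq D H) h = H ^ D)%N by rewrite big_nseq iter_muln_1.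
under eq_bigr do rewrite mul1r.
rewrite mul1r; set S := \sum_(1 <= j < n) _ => h.
have bH : n%:R ^+ k <= 2 * (8 * k)%:R ^+ k * `|((H ^ D)%N%:Z * b)%:~R| :> R.
  apply: (le_trans nkD_le); rewrite -intr_norm normrM intrM -pmulrn.
  have := nD_le; have : 0 <= `|b|%:~R :> R by rewrite ler0z.
  set B := `|b|%:~R; set X := n%:R ^+ D; set Y := H%:R ^+ D.
  by rewrite ger0_norm// -pmulrn natrX -/Y; nra.
have bH2 : n%:R ^+ (2 * k) <=
    4 * (8 * k)%:R ^+ (2 * k) * ((H ^ D)%N%:Z * b)%:~R ^+ 2 :> R.
  rewrite mulnC !exprM.
  have := bH; rewrite -(@ler_pXn2r _ 2%N) ?nnegrE ?mulr_ge0 ?exprn_ge0//.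
  by rewrite !exprMn real_normK ?num_real//; lra.
rewrite exprSr; apply: (@le_trans _ _
  (4 * (8 * k)%:R ^+ (2 * k) * ((H ^ D)%N%:Z * b)%:~R ^+ 2 * n%:R)).
  by rewrite ler_wpM2r.
rewrite [4 ^+ k.+2]exprS; set c := (8 * k)%:R ^+ _ in bH2 *.
have c0 : 0 <= c by rewrite exprn_ge0.
by have := ler_wpM2l c0 h; lra.
Qed.

Let K1 : R := 2 ^+ (k + 2).
Let K2 : R := (8 * k)%:R ^+ k * K1.
Let K3 : R := 4 * k.+1%:R.

Let K1_ge0 : 0 <= K1. Proof. exact: exprn_ge0. Qed.
Let K2_ge0 : 0 <= K2. Proof. by rewrite mulr_ge0// exprn_ge0. Qed.

Section FixedAlpha.
Variables al s : R.
Hypothesis s0 : 0 <= s.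
Hypothesis Qs : \sum_(1 <= j < n) sqsin (al * (Fint n%:Z k j%:Z)%:~R) <= s ^+ 2 * n%:R.

(** The products h_1 ... h_D al b are all close to integers, by the bound on their
    images under sqsin. *)
Lemma near_top : 3 * (K1 * s) < 1 ->
  near_int (K1 * s / H%:R ^+ D) (al * b%:~R).
Proof.
move=> Ks; apply: near_int_prod_div => // hs hsD hsH.
have -> : K1 * s = 2 * (2 ^+ k.+1 * s) by rewrite /K1 addnS addn1 exprS; ring.
apply: near_int_sin; first by rewrite mulr_ge0 ?exprn_ge0.
rewrite [X in pi * X]mulrCA.
have := @top_difference_le sqsin al hs sqsin_ge0 sqsinB hsD hsH.
rewrite intrM -pmulrn /sqsin => h.
rewrite -(ler_pM2l n0); apply: (le_trans h).
rewrite exprMn -exprM mulnC exprM.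
have -> : (2 ^+ 2 : R) = 4 by rewrite -natrX.
have e0 : 0 <= 4 ^+ k.+1 :> R by exact: exprn_ge0.
by have := ler_wpM2l e0 Qs; lra.
Qed.

(** If every window of D + 1 consecutive points contained a point with a large
    value of sqsin, summing over the windows would exceed the total. *)
Lemma good_window : exists2 j0 : nat, (j0 + D < n)%N &
  forall i : nat, (i <= D)%N ->
    near_int (K3 * s) (al * (Fint n%:Z k (j0%:Z + i%:Z))%:~R).
Proof.
pose q (j : nat) := sqsin (al * (Fint n%:Z k j%:Z)%:~R).
suff [j0 j0M qs] : exists2 j0 : nat, (1 <= j0 < M.+1)%N &
    \sum_(i < D.+1) q (j0 + i)%N <= 4 * k.+1%:R * s ^+ 2.
  exists j0 => [|i iD]; first exact: leq_ltn_trans (leq_add (ltnW (andP j0M).2) (leqnn D)) MDn.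
  have -> : K3 * s = 2 * (2 * k.+1%:R * s) by rewrite /K3; ring.
  apply: near_int_sin; first by rewrite !mulr_ge0.
  apply: (@le_trans _ _ (4 * k.+1%:R * s ^+ 2)).
    apply: le_trans qs; rewrite (bigD1 (Ordinal (iD : (i < D.+1)%N)))//= lerDl.
    by rewrite sumr_ge0// => j _; exact: sqsin_ge0.
  rewrite !exprMn ler_wpM2r ?sqr_ge0// -!natrX -!natrM ler_nat.
  by rewrite leq_mul2l /= expnS leq_pmulr.
apply: contrapT => /forall2NP qs.
have : \sum_(1 <= j < M.+1) (4 * k.+1%:R * s ^+ 2) <
       \sum_(1 <= j < M.+1) \sum_(i < D.+1) q (j + i)%N.
  rewrite !big_nat; apply: ltr_sum => [|j jM].
    by apply/hasP; exists 1%N; rewrite ?mem_index_iota ?ltnS ?M_gt0.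
  by have [//|/negP] := qs j; rewrite -ltNge.
rewrite sumr_const_nat subn1 /= exchange_big /= ltNge => /negP; apply.
apply: (@le_trans _ _ (\sum_(i < D.+1) s ^+ 2 * n%:R)).
  apply: ler_sum => i _; apply: le_trans Qs.
  have iD := ltn_ord i.
  rewrite (_ : \sum_(1 <= j < M.+1) q (j + i)%N = \sum_(1 + i <= j < M.+1 + i) q j).
    have c2 : (M.+1 + i <= n)%N.
      by apply: leq_trans (ltnW MDn); rewrite leq_add2l -ltnS.
    have c1 : (1 + i <= M.+1 + i)%N by rewrite leq_add2r.
    have c0 : (1 <= 1 + i)%N by [].
    rewrite [leRHS](@big_cat_nat _ _ _ (1 + i) _ _ _ _ c0 (leq_trans c1 c2))/=.
    rewrite [X in _ <= _ + X](@big_cat_nat _ _ _ (M.+1 + i) _ _ _ _ c1 c2)/=.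
    rewrite addrCA lerDl addr_ge0// sumr_ge0// => j _; exact: sqsin_ge0.
  by rewrite [RHS]big_addn addnK.
rewrite sumr_const card_ord -[leLHS]mulr_natl -[leRHS]mulr_natl.
have Dk1 : D.+1%:R <= k.+1%:R :> R by rewrite ler_nat.
have Q0 := sqr_ge0 s; have Mn := M_lb.
apply: (@le_trans _ _ (k.+1%:R * (s ^+ 2 * n%:R))).
  by rewrite ler_wpM2r// mulr_ge0.
have ks0 : 0 <= k.+1%:R * s ^+ 2 by rewrite mulr_ge0.
by have := ler_wpM2l ks0 Mn; lra.
Qed.

(** With m the integer close to al b, the number al is close to m / b.  In a good
    window (m / b) F is close to an integer and has a bounded denominator, so it
    is an integer; then b divides m g.  As |al| <= 1 / (2 g), this leaves
    m = 0. *)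
Lemma alpha_small :
  (2 * k`!%:R * (K3 + 6 * K2) + 4 * K2 + 3 * K1) * s < 1 ->
  `|al| * (2 * (gcdF n%:Z k)%:~R) <= 1 ->
  `|al| * n%:R ^+ k <= 2 * K2 * s.
Proof.
move=> sB ag.
have f0 : 0 <= k`!%:R :> R by [].
have K3_ge0 : 0 <= K3 by rewrite mulr_ge0.
have fK : 0 <= 2 * k`!%:R * (K3 + 6 * K2) by rewrite !mulr_ge0 ?addr_ge0 ?mulr_ge0.
have fKs : 0 <= 2 * k`!%:R * (K3 + 6 * K2) * s by rewrite mulr_ge0.
have K1s : 0 <= K1 * s by rewrite mulr_ge0.
have K2s : 0 <= K2 * s by rewrite mulr_ge0.
have sB1 : 3 * (K1 * s) < 1 by lra.
have sB2 : 2 * k`!%:R * (K3 * s + 6 * K2 * s) < 1 by lra.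
have sB3 : 4 * K2 * s < 1 by lra.
have [m mE] := near_top sB1.
set eps := al * b%:~R - m%:~R in mE.
have b0 : b != 0 by rewrite /b /Ftop; clear -n8k k2; case: ifP; lia.
have bR0 : 0 < `|b|%:~R :> R by rewrite ltr0z normr_gt0.
have bRn : b%:~R != 0 :> R by rewrite intr_eq0.
have HD0 : 0 < H%:R ^+ D :> R by rewrite exprn_gt0// ltr0n.
have epsn : `|eps| * n%:R ^+ k <= 2 * `|b|%:~R * (K2 * s).
  have h1 : `|eps| * H%:R ^+ D <= K1 * s by rewrite -ler_pdivlMr.
  have h2 : `|eps| * n%:R ^+ D <= K2 * s.
    apply: (@le_trans _ _ (`|eps| * ((8 * k)%:R ^+ k * H%:R ^+ D))).
      by rewrite ler_wpM2l// nD_le.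
    rewrite mulrCA /K2 -mulrA ler_wpM2l// exprn_ge0//.
  apply: (@le_trans _ _ (`|eps| * (2 * `|b|%:~R * n%:R ^+ D))).
    by rewrite ler_wpM2l// nkD_le.
  by rewrite mulrCA ler_wpM2l// ltW// mulr_gt0.
have [j0 j0n win] := good_window.
have bF x : (b %| m * Fint n%:Z k x)%Z.
  apply: (@dvdz_of_window D (fun x => m * Fint n%:Z k x) (m * b) b j0).
    by move=> y; rewrite iter_fdiff_scale iter_fdiff_Ftop.
  move=> i iD; have [m' m'E] := win i iD; set F := Fint _ _ _ in m'E *.
  have /dvdzP[w wE] : (b %| 2 * k`!%:Z * F)%Z by exact: Ftop_dvd.
  have Fb : `|F%:~R| <= 3 * n%:R ^+ k :> R.
    rewrite -intr_norm -[3]/(3%:~R) -[n%:R]/(n%:Z%:~R) -rmorphXn -intrM ler_int.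
    by apply: Fint_bound; [clear -k2 n8k; lia|clear -iD j0n; lia].
  clearbody F.
  (* (m / b) F is within K3 s + 6 K2 s of an integer and lies in Z / (2 k!) *)
  have wm : (m * w - 2 * k`!%:Z * m')%:~R =
      2 * k`!%:R * ((al * F%:~R - m'%:~R) - eps / b%:~R * F%:~R) :> R.
    have : (2 * k`!%:Z * F)%:~R = (w * b)%:~R :> R by rewrite wE.
    rewrite !intrB !intrM -!pmulrn => wER.
    have -> : w%:~R = 2 * k`!%:R * F%:~R / b%:~R :> R by rewrite wER mulfK.
    by rewrite /eps; field.
  have : `|(m * w - 2 * k`!%:Z * m')%:~R| < 1 :> R.
    rewrite wm normrM ger0_norm ?mulr_ge0//.
    apply: (@le_lt_trans _ _ (2 * k`!%:R * (K3 * s + 6 * K2 * s))); last by [].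
    rewrite ler_wpM2l ?mulr_ge0//; apply: le_trans (ler_normB _ _) _.
    rewrite lerD// normrM normrM normfV -intr_norm mulrAC ler_pdivrMr//.
    apply: (@le_trans _ _ (`|eps| * (3 * n%:R ^+ k))); first by rewrite ler_wpM2l.
    by lra.
  rewrite -intr_norm ltrz1 => mw0.
  have mwE : m * w = 2 * k`!%:Z * m' by clear -mw0; lia.
  have kf : 2 * k`!%:Z != 0 by have := fact_gt0 k; clear; lia.
  apply/dvdzP; exists m'; apply: (mulfI kf).
  by rewrite mulrCA wE !mulrA mwE.
have /dvdzP[l lE] := dvdz_mul_gcdF b0 bF.
have /andP[g0 gn] := @gcdF_le n k k2 ltac:(clear -n8k; lia).
set g := gcdF _ _ in ag lE g0 gn.
have nk_ge : n%:R <= n%:R ^+ k :> R.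
  by rewrite -[X in X <= _]expr1 ler_weXn2l ?ler1n; clear -k2 n8k; lia.
have gR0 : 0 < g%:~R :> R by rewrite ltr0z.
have gRn : g%:~R <= n%:R ^+ k :> R.
  by apply: le_trans nk_ge; rewrite -[n%:R]/(n%:Z%:~R) ler_int.
have m0 : m = 0.
  apply: contrapT => /eqP mn0.
  have bmg : `|b|%:~R <= `|m%:~R| * g%:~R :> R.
    rewrite -[g%:~R]gtr0_norm// -normrM -intrM -intr_norm lE ler_int normrM.
    rewrite ler_peMl//; suff : l != 0 by clear; lia.
    by apply: contraNneq mn0 => l0; move/eqP: lE; rewrite l0 mul0r mulf_eq0 (gt_eqF g0) orbF.
  have mlt : `|m%:~R| <= `|al| * `|b|%:~R + `|eps| :> R.
    have -> : m%:~R = al * b%:~R - eps by rewrite /eps; ring.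
    by apply: le_trans (ler_normB _ _) _; rewrite normrM -intr_norm.
  have e1 : `|eps| * g%:~R <= 2 * `|b|%:~R * (K2 * s).
    by apply: le_trans epsn; rewrite ler_wpM2l.
  have e2 : `|m%:~R| * g%:~R <= (`|al| * `|b|%:~R + `|eps|) * g%:~R :> R.
    by rewrite ler_wpM2r// ltW.
  have e3 := ler_wpM2l (ltW bR0) ag.
  have : 0 < `|b|%:~R * (1 - 4 * K2 * s) by rewrite mulr_gt0// subr_gt0.
  by lra.
have epsE : eps = al * b%:~R by rewrite /eps m0 subr0.
move: epsn; rewrite epsE normrM -intr_norm -mulrA mulrCA -mulrA mulrCA => epsn.
by rewrite -(ler_pM2l bR0); lra.
Qed.

End FixedAlpha.
End FixedN.

(** The sum Q controls the decay of the characteristic function at the frequency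
    2 pi al: it is either of the order of n, or as large as it would be if all the
    numbers al F(j) were their own distances to the integers. *)
Lemma key_estimate : exists (e0 C : R), 0 < e0 /\ 0 < C /\
  forall (n : nat) (al : R), (8 * k <= n)%N ->
  `|al| * (2 * (gcdF n%:Z k)%:~R) <= 1 ->
  let Q := \sum_(1 <= j < n) sqsin (al * (Fint n%:Z k j%:Z)%:~R) in
  Q <= e0 * n%:R -> al ^+ 2 * n%:R ^+ (2 * k) * n%:R <= C * Q.
Proof.
pose K1 : R := 2 ^+ (k + 2); pose K2 : R := (8 * k)%:R ^+ k * K1.
pose B : R := 2 * k`!%:R * (4 * k.+1%:R + 6 * K2) + 4 * K2 + 3 * K1.
have K1_gt0 : 0 < K1 by exact: exprn_gt0.
have K2_gt0 : 0 < K2 by rewrite mulr_gt0// exprn_gt0// ltr0n; lia.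
have B0 : 0 < B.
  have : 0 <= 2 * k`!%:R * (4 * k.+1%:R + 6 * K2) :> R.
    by rewrite !mulr_ge0// addr_ge0// mulr_ge0// ltW.
  by rewrite /B; lra.
exists ((2 * B)^-1 ^+ 2), (4 * K2 ^+ 2); split; first by rewrite exprn_gt0// invr_gt0 mulr_gt0.
split; first by rewrite mulr_gt0// exprn_gt0.
move=> n al n8k ag Q Qe.
have n0 : 0 < n%:R :> R by rewrite ltr0n; lia.
have Q0 : 0 <= Q by rewrite sumr_ge0// => j _; exact: sqsin_ge0.
pose s := Num.sqrt (Q / n%:R).
have sE : s ^+ 2 = Q / n%:R by rewrite sqr_sqrtr// divr_ge0// ltW.
have s0 : 0 <= s by exact: sqrtr_ge0.
have sB : s <= (2 * B)^-1.
  rewrite -(@ler_pXn2r _ 2%N) ?nnegrE ?invr_ge0 ?mulr_ge0 ?(ltW B0)//.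
  by rewrite sE ler_pdivrMr.
have sB1 : B * s < 1.
  apply: (@le_lt_trans _ _ (B * (2 * B)^-1)); first by rewrite ler_pM2l.
  by rewrite invfM mulrCA divff ?gt_eqF// mulr1 invf_lt1// ltr1n.
have := @alpha_small n n8k al s s0 _ sB1 ag.
rewrite sE divfK ?gt_eqF// lexx => /(_ isT).
rewrite -/K1 -/K2 -(@ler_pXn2r _ 2%N) ?nnegrE ?mulr_ge0 ?exprn_ge0 ?(ltW K2_gt0)//.
rewrite exprMn real_normK ?num_real// -exprM mulnC !exprMn sE => h.
have := ler_wpM2r (ltW n0) h.
by rewrite [_ * (Q / _)]mulrA divfK ?gt_eqF//; have -> : (2 ^+ 2 : R) = 4 by rewrite -natrX.
Qed.

End KeyEstimate.

(** * Means over independent Bernoulli variables *)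

Section BernoulliMean.
Context {R : realType}.
Variable p : R.
Hypothesis p01 : 0 <= p <= 1.
Implicit Types (s : seq R) (f g : R -> R).

(** The mean of f at the sum of the a X_a, for independent Bernoulli variables X_a
    indexed by the entries a of s: the recursion conditions on the first one. *)
Fixpoint bernE s f : R :=
  if s is a :: s' then p * bernE s' (fun x => f (a + x)) + (1 - p) * bernE s' f
  else f 0.

(** Only the values of f on the sums of entries of s matter; A is typically a
    lattice containing them. *)
Lemma bernE_eq_in (A : R -> Prop) s f g :
  A 0 -> (forall a, a \in s -> forall x, A x -> A (a + x)) ->
  (forall x, A x -> f x = g x) -> bernE s f = bernE s g.
Proof.
move=> A0; elim: s f g => /= [|a s IH] f g As fg; first exact: fg.
have As' b : b \in s -> forall x, A x -> A (b + x).
  by move=> bs; apply: As; rewrite in_cons bs orbT.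
rewrite (IH f g)// (IH (fun x => f (a + x)) (fun x => g (a + x)))// => x Ax.
by apply: fg; apply: As => //; exact: mem_head.
Qed.

Lemma eq_bernE s f g : f =1 g -> bernE s f = bernE s g.
Proof. by move=> fg; apply: (@bernE_eq_in (fun=> True)). Qed.

Lemma bernE_lin s c d f g :
  bernE s (fun x => c * f x + d * g x) = c * bernE s f + d * bernE s g.
Proof. by elim: s f g => //= a s IH f g; rewrite !IH; ring. Qed.

Lemma bernE_scale s c f : bernE s (fun x => c * f x) = c * bernE s f.
Proof. by elim: s f => //= a s IH f; rewrite !IH; ring. Qed.

Lemma bernE_cst s c : bernE s (fun=> c) = c.
Proof. by elim: s => //= a s ->; ring. Qed.

Lemma bernE_id s : bernE s id = p * \sum_(a <- s) a.
Proof.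
elim: s => [|a s IH]; first by rewrite big_nil mulr0.
rewrite /= big_cons (eq_bernE s (g := fun x => a * 1 + 1 * x)) => [|x]; last by ring.
by rewrite (bernE_lin s a 1 (fun=> 1) id) bernE_cst IH; ring.
Qed.

Lemma bernE_sqr s c : bernE s (fun x => (x - c) ^+ 2) =
  p * (1 - p) * \sum_(a <- s) a ^+ 2 + (p * \sum_(a <- s) a - c) ^+ 2.
Proof.
elim: s c => [|a s IH] c; first by rewrite !big_nil /=; ring.
rewrite /= !big_cons IH (eq_bernE s (g := fun x => (x - (c - a)) ^+ 2)) => [|x].
  by rewrite IH; ring.
by ring.
Qed.

Lemma bernE_cosD s th be : bernE s (fun x => cos (th * x + be)) =
  cos be * bernE s (fun x => cos (th * x)) - sin be * bernE s (fun x => sin (th * x)).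
Proof.
rewrite -mulNr -bernE_lin; apply: eq_bernE => x.
by rewrite cosD; ring.
Qed.

Lemma bernE_sinD s th be : bernE s (fun x => sin (th * x + be)) =
  sin be * bernE s (fun x => cos (th * x)) + cos be * bernE s (fun x => sin (th * x)).
Proof.
by rewrite -bernE_lin; apply: eq_bernE => x; rewrite sinD; ring.
Qed.

(** The left-hand side is the squared modulus of the characteristic function, and
    the factors on the right are the |1 - p + p exp (i th a)|^2.  The addition
    formulas replace complex multiplication. *)
Lemma bernE_modulus s th :
  bernE s (fun x => cos (th * x)) ^+ 2 + bernE s (fun x => sin (th * x)) ^+ 2 =
  \prod_(a <- s) (1 - 4 * p * (1 - p) * sin (th * a / 2) ^+ 2).
Proof.
elim: s => [|a s IH]; first by rewrite big_nil /= mulr0 cos0 sin0; ring.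
rewrite big_cons -IH /=.
have addE x : th * (a + x) = th * x + th * a by ring.
rewrite (eq_bernE s (f := fun x => cos (th * (a + x))) (g := fun x => cos (th * x + th * a))); last first.
  by move=> x; rewrite addE.
rewrite (eq_bernE s (f := fun x => sin (th * (a + x))) (g := fun x => sin (th * x + th * a))); last first.
  by move=> x; rewrite addE.
rewrite bernE_cosD bernE_sinD; set A := bernE _ _; set B := bernE _ _.
have hE : th * a = (th * a / 2) *+ 2 by rewrite -mulr_natr; field.
have -> : sin (th * a) = 2 * cos (th * a / 2) * sin (th * a / 2).
  by rewrite [in LHS]hE sin_mulr2n; ring.
have -> : cos (th * a) = 1 - 2 * sin (th * a / 2) ^+ 2.
  by rewrite [in LHS]hE cos_mulr2n cos2sin2; ring.
have := cos2Dsin2 (th * a / 2); set c := cos _; set d := sin _ => cd.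
have -> : 1 - 4 * p * (1 - p) * d ^+ 2 =
  (1 - 2 * p * d ^+ 2) ^+ 2 + 4 * p ^+ 2 * c ^+ 2 * d ^+ 2.
  have -> : c ^+ 2 = 1 - d ^+ 2 by rewrite -cd; ring.
  by ring.
by ring.
Qed.

Lemma bernE_cos_sqr_le s th be :
  bernE s (fun x => cos (th * x + be)) ^+ 2 <=
  expR (- (4 * p * (1 - p) * \sum_(a <- s) sin (th * a / 2) ^+ 2)).
Proof.
apply: (@le_trans _ _ (\prod_(a <- s) (1 - 4 * p * (1 - p) * sin (th * a / 2) ^+ 2))).
  rewrite -bernE_modulus bernE_cosD; have := cos2Dsin2 be.
  set A := bernE _ _; set B := bernE _ _; set c := cos be; set d := sin be => cd.
  have : A ^+ 2 + B ^+ 2 - (c * A - d * B) ^+ 2 = (d * A + c * B) ^+ 2.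
    have -> : A ^+ 2 + B ^+ 2 = (c ^+ 2 + d ^+ 2) * (A ^+ 2 + B ^+ 2) by rewrite cd mul1r.
    by ring.
  by have := sqr_ge0 (d * A + c * B); lra.
elim: s => [|a s IH]; first by rewrite !big_nil mulr0 oppr0 expR0.
rewrite !big_cons (mulrDr (4 * p * (1 - p))) opprD expRD; set y := 4 * p * (1 - p) * sin (th * a / 2) ^+ 2.
have p4 : 0 <= 4 * p * (1 - p) <= 1 by case/andP: p01 => p0 p1; apply/andP; split; have := sqr_ge0 (2 * p - 1); nra.
have s1 : 0 <= sin (th * a / 2) ^+ 2 <= 1.
  by rewrite sqr_ge0 sin2cos2 gerBl sqr_ge0.
have y01 : 0 <= 1 - y by rewrite subr_ge0 /y; nra.
have ey : 1 - y <= expR (- y) by have := expR_ge1Dx (- y); lra.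
apply: le_trans (ler_wpM2l y01 IH) _.
by rewrite ler_wpM2r ?expR_ge0.
Qed.

(** Taylor expansion in u at order two: the linear terms cancel since the variable
    is centred, and the quadratic ones match those of the exponential. *)
Lemma one_step_gauss (u be : R) :
  `|p * cos (be + u * (1 - p)) + (1 - p) * cos (be - u * p)
    - expR (- (p * (1 - p) * u ^+ 2 / 2)) * cos be| <= 2 * p * `|u| ^+ 3.
Proof.
set U := `|u| ^+ 3; have U0 : 0 <= U by exact: exprn_ge0.
case/andP: p01 => p0 p1; have q0 : 0 <= 1 - p by rewrite subr_ge0.
have pU : 0 <= p * U by rewrite mulr_ge0.
set y := p * (1 - p) * u ^+ 2 / 2.
have y0 : 0 <= y by rewrite /y divr_ge0// mulr_ge0 ?sqr_ge0// mulr_ge0.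
have b1 : `|u * (1 - p)| ^+ 3 / 6 <= U / 6.
  rewrite normrM exprMn (ger0_norm q0) ler_pM2r ?invr_gt0// ler_piMr//.
  by rewrite exprn_ile1// gerBl.
have b2 : `|u * p| ^+ 3 / 6 <= p * U / 6.
  rewrite normrM exprMn (ger0_norm p0) ler_pM2r ?invr_gt0// mulrC ler_wpM2r//.
  by rewrite exprS ler_piMr// exprn_ile1.
have yU : `|expR (- y) - 1 + y| <= p * U.
  have [u1|u1] := leP `|u| 1.
    apply: le_trans (expRN_le_quad y0) _.
    have pp : (p * (1 - p)) ^+ 2 <= p.
      rewrite exprMn expr2 -mulrA ler_piMr//.
      by rewrite mulr_ile1 ?sqr_ge0// exprn_ile1// gerBl.
    have -> : y ^+ 2 / 2 = (p * (1 - p)) ^+ 2 * (`|u| * U) / 8.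
      rewrite /U -exprS -[(3.+1)%N]/(2 * 2)%N exprM real_normK ?num_real// /y.
      by field.
    have uU : `|u| * U <= U by rewrite ler_piMl.
    have uU0 : 0 <= `|u| * U by rewrite mulr_ge0.
    have := ler_pM (sqr_ge0 _) uU0 pp uU.
    by lra.
  have e1 : expR (- y) <= 1 by rewrite expR_le1 oppr_le0.
  have e2 : 1 - y <= expR (- y) by have := expR_ge1Dx (- y); lra.
  rewrite ger0_norm; last by lra.
  apply: (@le_trans _ _ y); first by lra.
  have uU : u ^+ 2 <= U.
    by rewrite /U [leRHS]exprSr real_normK ?num_real// ler_peMr ?sqr_ge0// ltW.
  rewrite /y; have : p * (1 - p) * u ^+ 2 <= p * U.
    rewrite -mulrA ler_wpM2l//; apply: le_trans uU.
    by rewrite ler_piMl ?sqr_ge0// gerBl.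
  by lra.
have c1 := cos_le_cubic (u * (1 - p)); have c2 := cos_le_cubic (u * p).
have d1 := sin_le_cubic (u * (1 - p)); have d2 := sin_le_cubic (u * p).
set C1 := cos (u * (1 - p)) - 1 + _ in c1; set C2 := cos (u * p) - 1 + _ in c2.
set D1 := sin (u * (1 - p)) - _ in d1; set D2 := sin (u * p) - _ in d2.
set E := expR (- y) - 1 + y in yU.
have -> : p * cos (be + u * (1 - p)) + (1 - p) * cos (be - u * p) -
    expR (- y) * cos be =
    cos be * (p * C1 + (1 - p) * C2 - E) - sin be * (p * D1 - (1 - p) * D2).
  by rewrite cosD cosB /C1 /C2 /D1 /D2 /E /y; field.
have bnd (w z c : R) : `|w| <= 1 -> `|z| <= c -> `|w * z| <= c.
  by move=> w1 zc; rewrite normrM; apply: le_trans zc; rewrite ler_piMl.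
apply: le_trans (ler_normB _ _) _.
have B1 : `|cos be * (p * C1 + (1 - p) * C2 - E)| <= 4 / 3 * (p * U).
  apply: bnd; first exact: cos_max.
  apply: le_trans (ler_normB _ _) _; apply: (@le_trans _ _ (p * U / 6 + p * U / 6 + p * U)); last by lra.
  apply: lerD => //; apply: le_trans (ler_normD _ _) _; apply: lerD.
    rewrite normrM (ger0_norm p0) -mulrA ler_wpM2l//; exact: le_trans b1.
  rewrite normrM (ger0_norm q0); apply: (@le_trans _ _ `|C2|); first by rewrite ler_piMl// gerBl.
  exact: le_trans b2.
have B2 : `|sin be * (p * D1 - (1 - p) * D2)| <= 1 / 3 * (p * U).
  apply: bnd; first exact: sin_max.
  apply: (@le_trans _ _ (p * U / 6 + p * U / 6)); last by lra.
  apply: le_trans (ler_normB _ _) _; apply: lerD.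
    rewrite normrM (ger0_norm p0) -mulrA ler_wpM2l//; exact: le_trans b1.
  rewrite normrM (ger0_norm q0); apply: (@le_trans _ _ `|D2|); first by rewrite ler_piMl// gerBl.
  exact: le_trans b2.
by rewrite -mulrA; lra.
Qed.

(** Replace the variables by Gaussian ones with the same variances, one at a time.
    The bound of each replacement is uniform in be, into which the other terms of
    the sum are absorbed. *)
Lemma bernE_gauss s th be :
  `|bernE s (fun x => cos (th * (x - p * \sum_(a <- s) a) + be))
    - expR (- (p * (1 - p) * (\sum_(a <- s) a ^+ 2) * th ^+ 2 / 2)) * cos be|
  <= 2 * `|th| ^+ 3 * (p * \sum_(a <- s) `|a| ^+ 3).
Proof.
case/andP: p01 => p0 p1; have q0 : 0 <= 1 - p by rewrite subr_ge0.
elim: s be => [|a s IH] be.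
  by rewrite /= !big_nil !(mulr0, mul0r, subr0, oppr0, expR0, mul1r, add0r) subrr normr0.
rewrite /= !big_cons; set M := \sum_(b <- s) b; set V := \sum_(b <- s) b ^+ 2.
set L := \sum_(b <- s) `|b| ^+ 3; set u := th * a.
rewrite (eq_bernE s (f := fun x => cos (th * (a + x - p * (a + M)) + be))
  (g := fun x => cos (th * (x - p * M) + (be + u * (1 - p))))); last first.
  by move=> x; congr cos; rewrite /u; ring.
rewrite (eq_bernE s (f := fun x => cos (th * (x - p * (a + M)) + be))
  (g := fun x => cos (th * (x - p * M) + (be - u * p)))); last first.
  by move=> x; congr cos; rewrite /u; ring.
have I1 := IH (be + u * (1 - p)); have I2 := IH (be - u * p).
rewrite -/M -/V -/L in I1 I2.
set e := expR _ in I1 I2; set X1 := bernE s _ in I1 *; set X2 := bernE s _ in I2 *.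
have -> : expR (- (p * (1 - p) * (a ^+ 2 + V) * th ^+ 2 / 2)) =
    e * expR (- (p * (1 - p) * u ^+ 2 / 2)).
  by rewrite -expRD; congr expR; rewrite /u; field.
have e01 : 0 <= e <= 1.
  rewrite expR_ge0 expR_le1 oppr_le0 divr_ge0// mulr_ge0 ?sqr_ge0// !mulr_ge0//.
  by rewrite sumr_ge0// => i _; exact: sqr_ge0.
have O := one_step_gauss u be; set f := expR _ in O *; set G := _ - _ in O.
have -> : p * X1 + (1 - p) * X2 - e * f * cos be =
  p * (X1 - e * cos (be + u * (1 - p))) + (1 - p) * (X2 - e * cos (be - u * p)) + e * G.
  by rewrite /G; ring.
have -> : 2 * `|th| ^+ 3 * (p * (`|a| ^+ 3 + L)) =
    p * (2 * `|th| ^+ 3 * (p * L)) + (1 - p) * (2 * `|th| ^+ 3 * (p * L)) +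
    2 * p * `|u| ^+ 3.
  by rewrite /u normrM exprMn; ring.
apply: le_trans (ler_normD _ _) _; apply: lerD.
  apply: le_trans (ler_normD _ _) _; apply: lerD.
    by rewrite normrM (ger0_norm p0) ler_wpM2l.
  by rewrite normrM (ger0_norm q0) ler_wpM2l.
rewrite normrM ger0_norm; last by case/andP: e01.
by apply: le_trans O; rewrite ler_piMl//; case/andP: e01.
Qed.

End BernoulliMean.

(** * Integrals of continuous functions over a segment *)

Section SegmentIntegral.
Context {R : realType}.
Notation mu := (@lebesgue_measure R).
Implicit Types (f g F : R -> R) (a b c : R).

Definition cint a b f : R := (\int[mu]_(x in `[a, b]) f x)%R.

Lemma is_derive_continuous f (df : R -> R) :
  (forall x : R, is_derive x 1 f (df x)) -> continuous f.
Proof.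
move=> fD x; apply: differentiable_continuous; apply/derivable1_diffP.
by have [] := fD x.
Qed.

Lemma cint_integrable a b f : continuous f -> mu.-integrable `[a, b] (EFin \o f).
Proof.
move=> cf; apply: continuous_compact_integrable; first exact: segment_compact.
exact: continuous_subspaceT.
Qed.

Lemma cintD a b f g : continuous f -> continuous g ->
  cint a b (fun x => f x + g x) = cint a b f + cint a b g.
Proof. by move=> cf cg; rewrite /cint RintegralD//; exact: cint_integrable. Qed.

Lemma cintB a b f g : continuous f -> continuous g ->
  cint a b (fun x => f x - g x) = cint a b f - cint a b g.
Proof. by move=> cf cg; rewrite /cint RintegralB//; exact: cint_integrable. Qed.

Lemma cintZ a b c f : continuous f -> cint a b (fun x => c * f x) = c * cint a b f.
Proof. by move=> cf; rewrite /cint RintegralZl//; exact: cint_integrable. Qed.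

Lemma eq_cint a b f g : (forall x, a <= x <= b -> f x = g x) ->
  cint a b f = cint a b g.
Proof. by move=> fg; apply: eq_Rintegral => x /set_mem /=; rewrite in_itv => /fg. Qed.

Lemma cint_cst a b c : a <= b -> cint a b (fun=> c) = c * (b - a).
Proof.
move=> ab; rewrite /cint Rintegral_cst//= lebesgue_measure_itv/= lte_fin.
case: ltP => // ba; have -> : a = b by apply/eqP; rewrite eq_le ab.
by rewrite subrr.
Qed.

Lemma cint_normr_le a b f g : continuous f -> continuous g ->
  (forall x, a <= x <= b -> `|f x| <= g x) -> `|cint a b f| <= cint a b g.
Proof.
move=> cf cg fg; rewrite /cint.
have i1 := @cint_integrable a b f cf.
apply: le_trans; first exact: (le_normr_Rintegral _ i1).
have i2 : mu.-integrable `[a, b] (EFin \o (fun x => `|f x|)).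
  by apply: cint_integrable => x; apply: cvg_norm; exact: cf.
have i3 := @cint_integrable a b g cg.
by apply: (le_Rintegral _ i2 i3) => // x /=; rewrite in_itv => /fg.
Qed.

Lemma cint_cat a b c f : continuous f -> a <= b -> b <= c ->
  cint a c f = cint a b f + cint b c f.
Proof.
move=> cf ab bc; have i1 := @cint_integrable a c f cf.
have := @Rintegral_itvB R f (BLeft a) (BRight c) b i1.
rewrite !bnd_simp => /(_ ab bc).
rewrite Rintegral_itv_obnd_cbnd; last first.
  by apply: integrableS (@cint_integrable b c f cf) => //; apply: subset_itvr; rewrite bnd_simp.
by rewrite /cint => <-; rewrite addrC subrK.
Qed.

Lemma cint_derive a b f F : a <= b -> (forall x : R, is_derive x 1 F (f x)) ->
  continuous f -> cint a b f = F b - F a.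
Proof.
rewrite le_eqVlt => /predU1P[->|ab] FD cf.
  by rewrite /cint set_itv1 Rintegral_set1 subrr.
rewrite /cint /Rintegral.
have cF : continuous F by exact: is_derive_continuous FD.
rewrite (@continuous_FTC2 _ f F)//.
- exact: continuous_subspaceT.
- split.
  + by move=> x _; have [] := FD x.
  + by apply: cvg_at_right_filter; exact: cF.
  + by apply: cvg_at_left_filter; exact: cF.
- by move=> x _; rewrite derive1E; have [] := FD x.
Qed.

Lemma bernE_continuous (p : R) s (f : R -> R -> R) :
  (forall x, continuous (f ^~ x)) -> continuous (fun t => bernE p s (f t)).
Proof.
elim: s f => [|a s IH] f cf t /=; first exact: cf.
apply: cvgD; (apply: cvgM; first exact: cvg_cst).
- by apply: (IH (fun t x => f t (a + x))) => x; exact: cf.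
- exact: IH.
Qed.

Lemma bernE_cint (p : R) s a b (f : R -> R -> R) :
  (forall x, continuous (f ^~ x)) ->
  bernE p s (fun x => cint a b (f ^~ x)) = cint a b (fun t => bernE p s (f t)).
Proof.
elim: s f => [|c s IH] f cf //=.
rewrite (IH (fun t x => f t (c + x))) ?IH//.
have c1 : continuous (fun t => bernE p s (f t)) by exact: bernE_continuous.
have c2 : continuous (fun t => bernE p s (fun x => f t (c + x))).
  by apply: (@bernE_continuous p s (fun t x => f t (c + x))).
rewrite cintD ?cintZ//.
- by move=> t; apply: cvgM; [exact: cvg_cst|exact: c2].
- by move=> t; apply: cvgM; [exact: cvg_cst|exact: c1].
Qed.

(** This replaces differentiation under the integral sign: a uniform second order
    estimate of an integrand can be integrated directly. *)
Lemma is_derive_quadratic f (x d C : R) :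
  (forall h, `|h| <= 1 -> `|f (x + h) - f x - h * d| <= C * h ^+ 2) ->
  is_derive x 1 f d.
Proof.
move=> fC.
have C0 : 0 <= C.
  by have := fC 1; rewrite normr1 expr1n mulr1 lexx => /(_ isT); exact: le_trans.
have lim : h^-1 *: (f (h *: 1 + x) - f x) @[h --> 0^'] --> d.
  apply/cvgrPdist_le => /= e e0; near=> h.
  have h0 : h != 0 by near: h; exact: nbhs_dnbhs_neq.
  have h1 : `|h| <= 1.
    by near: h; apply: dnbhs0_le.
  have he : `|h| <= e / (C + 1).
    by near: h; apply: dnbhs0_le; rewrite divr_gt0// ltr_wpDl.
  have -> : d - h^-1 *: (f (h *: 1 + x) - f x) = - (h^-1 * (f (x + h) - f x - h * d)).
    by rewrite /GRing.scale/= mulr1 (addrC h); field.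
  rewrite normrN normrM normfV ler_pdivrMl ?normr_gt0//.
  apply: le_trans (fC h h1) _; rewrite -real_normK ?num_real// expr2 mulrCA.
  rewrite ler_wpM2l//; move: he; rewrite ler_pdivlMr; last by rewrite ltr_wpDl.
  by have := normr_ge0 h; lra.
split; first by apply/cvg_ex; exists d.
by apply/cvg_lim.
Unshelve. all: by end_near.
Qed.

Lemma is_derive_cosM (x w : R) : is_derive x 1 (fun t => cos (t * w)) (- (w * sin (x * w))).
Proof.
have D : is_derive x 1 (fun t : R => t * w) w.
  by apply: is_derive_eq; rewrite /GRing.scale/=; ring.
have H : is_derive x 1 (cos \o (fun t : R => t * w)) (- sin (x * w) * w).
  exact: is_derive1_comp.
by apply: (is_derive_eq H); ring.
Qed.

Lemma is_derive_sinM (x w : R) : is_derive x 1 (fun t => sin (t * w)) (w * cos (x * w)).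
Proof.
have D : is_derive x 1 (fun t : R => t * w) w.
  by apply: is_derive_eq; rewrite /GRing.scale/=; ring.
have H : is_derive x 1 (sin \o (fun t : R => t * w)) (cos (x * w) * w).
  exact: is_derive1_comp.
by apply: (is_derive_eq H); ring.
Qed.

Lemma is_derive_expq (x c : R) :
  is_derive x 1 (fun t => expR (c * t ^+ 2)) (2 * c * x * expR (c * x ^+ 2)).
Proof.
have D : is_derive x 1 (fun t : R => c * t ^+ 2) (2 * c * x).
  by apply: is_derive_eq; rewrite /GRing.scale/=; ring.
have H : is_derive x 1 (expR \o (fun t : R => c * t ^+ 2))
    (expR (c * x ^+ 2) * (2 * c * x)).
  exact: is_derive1_comp.
by apply: (is_derive_eq H); ring.
Qed.

Lemma cint_cos (B w : R) : 0 < B -> w != 0 ->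
  cint (- B) B (fun t => cos (t * w)) = 2 * sin (B * w) / w.
Proof.
move=> B0 w0.
have D (x : R) : is_derive x 1 (fun t => w^-1 * sin (t * w)) (cos (x * w)).
  have := is_derive_sinM x w => D.
  by apply: is_derive_eq; rewrite /GRing.scale /=; field.
have cc : continuous (fun t : R => cos (t * w)).
  by apply: is_derive_continuous => x; exact: is_derive_cosM.
by rewrite (cint_derive _ D cc) ?ge0_cp ?(ltW B0)// mulNr sinN; field.
Qed.

End SegmentIntegral.

(** * The Fourier transform of the Gaussian *)

Section GaussFourier.
Context {R : realType}.
Notation mu := (@lebesgue_measure R).
Implicit Types (A B x t : R).

Definition gauss_kernel t : R := expR (- 2^-1 * t ^+ 2).

(** A truncated integral, so that only continuous functions on segments are
    integrated; its limit as A grows is the Fourier transform of the Gaussian. *)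
Definition gauss_cos A x : R := cint (- A) A (fun t => cos (t * x) * gauss_kernel t).

Lemma is_derive_gauss_kernel t : is_derive t 1 gauss_kernel (- t * gauss_kernel t).
Proof. by apply: (is_derive_eq (is_derive_expq t (- 2^-1))); rewrite /gauss_kernel; field. Qed.

Lemma gauss_kernel_ge0 t : 0 <= gauss_kernel t.
Proof. exact: expR_ge0. Qed.

Lemma gauss_kernel_le1 t : gauss_kernel t <= 1.
Proof. by rewrite expR_le1 mulNr oppr_le0 mulr_ge0 ?sqr_ge0. Qed.

Lemma gauss_kernelN t : gauss_kernel (- t) = gauss_kernel t.
Proof. by rewrite /gauss_kernel sqrrN. Qed.

Lemma continuous_gauss_kernel : continuous gauss_kernel.
Proof. exact: is_derive_continuous is_derive_gauss_kernel. Qed.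

Lemma continuous_cosM x : continuous (fun t : R => cos (t * x)).
Proof. by apply: is_derive_continuous => t; exact: is_derive_cosM. Qed.

Lemma continuous_sinM x : continuous (fun t : R => sin (t * x)).
Proof. by apply: is_derive_continuous => t; exact: is_derive_sinM. Qed.

Lemma continuous_gauss_cos x : continuous (fun t => cos (t * x) * gauss_kernel t).
Proof.
move=> t; apply: cvgM; first exact: continuous_cosM.
exact: continuous_gauss_kernel.
Qed.

Lemma continuous_gauss_sin x : continuous (fun t => t * sin (t * x) * gauss_kernel t).
Proof.
move=> t; apply: cvgM; last exact: continuous_gauss_kernel.
by apply: cvgM; [exact: cvg_id|exact: continuous_sinM].
Qed.

Lemma gauss_cos_derive A x : 0 <= A ->
  is_derive x 1 (gauss_cos A) (- cint (- A) A (fun t => t * sin (t * x) * gauss_kernel t)).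
Proof.
move=> A0.
(* from the Taylor bounds for cos (t h) and sin (t h), with |t| <= A and |h| <= 1 *)
pose C := A ^+ 2 / 2 + A ^+ 3 / 6.
apply: (@is_derive_quadratic _ _ _ _ (C * (A - - A))) => h h1.
rewrite mulrN opprK /gauss_cos -cintZ; last exact: continuous_gauss_sin.
set f1 := fun t => cos (t * (x + h)) * _; set f0 := fun t => cos (t * x) * _.
set f2 := fun t => h * _.
have c1 : continuous f1 by exact: continuous_gauss_cos.
have c0 : continuous f0 by exact: continuous_gauss_cos.
have c2 : continuous f2.
  by move=> t; apply: cvgM; [exact: cvg_cst|exact: continuous_gauss_sin].
have c10 : continuous (fun t => f1 t - f0 t).
  by move=> t; apply: cvgB; [exact: c1|exact: c0].
rewrite -cintB// -cintD//.
have -> : C * (A - - A) * h ^+ 2 = cint (- A) A (fun=> C * h ^+ 2).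
  by rewrite cint_cst ?ge0_cp//; ring.
apply: cint_normr_le.
- by move=> t; apply: cvgD; [exact: c10|exact: c2].
- by move=> t; exact: cvg_cst.
move=> t tA; have tA' : `|t| <= A by rewrite ler_norml.
have -> : f1 t - f0 t + f2 t = (cos (t * x) * (cos (t * h) - 1)
    - sin (t * x) * (sin (t * h) - t * h)) * gauss_kernel t.
  by rewrite /f1 /f0 /f2 mulrDr cosD; ring.
rewrite normrM (ger0_norm (gauss_kernel_ge0 t)).
apply: (@le_trans _ _ (C * h ^+ 2 * 1)); last by rewrite mulr1.
apply: ler_pM => //; [exact: gauss_kernel_ge0| |exact: gauss_kernel_le1].
have th2 : (t * h) ^+ 2 <= A ^+ 2 * h ^+ 2.
  rewrite exprMn ler_wpM2r ?sqr_ge0// -(real_normK (num_real t)).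
  by rewrite ler_pXn2r ?nnegrE.
have th3 : `|t * h| ^+ 3 <= A ^+ 3 * h ^+ 2.
  rewrite normrM exprMn; apply: ler_pM; rewrite ?exprn_ge0//.
    by rewrite ler_pXn2r ?nnegrE.
  by rewrite exprSr real_normK ?num_real// ler_piMr ?sqr_ge0.
apply: le_trans (ler_normB _ _) _; rewrite /C mulrDl; apply: lerD.
  rewrite normrM; apply: (@le_trans _ _ (1 * `|cos (t * h) - 1|)).
    by rewrite ler_wpM2r// cos_max.
  have cq := cos_ge_quad (t * h); have c1' := cos_le1 (t * h).
  by rewrite mul1r ler0_norm; lra.
rewrite normrM; apply: (@le_trans _ _ (1 * `|sin (t * h) - t * h|)).
  by rewrite ler_wpM2r// sin_max.
by have := sin_le_cubic (t * h); lra.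
Qed.

Lemma gauss_cosN A x : gauss_cos A (- x) = gauss_cos A x.
Proof. by apply: eq_cint => t _; rewrite mulrN cosN. Qed.

Lemma gauss_sin_parts A x : 0 <= A ->
  cint (- A) A (fun t => t * sin (t * x) * gauss_kernel t) =
  x * gauss_cos A x - 2 * gauss_kernel A * sin (A * x).
Proof.
move=> A0.
have cxJ : continuous (fun t => x * (cos (t * x) * gauss_kernel t)).
  by move=> t; apply: cvgM; [exact: cvg_cst|exact: continuous_gauss_cos].
have cS := continuous_gauss_sin (x := x).
have D (t : R) : is_derive t 1 (fun t => - (gauss_kernel t * sin (t * x)))
    (t * sin (t * x) * gauss_kernel t - x * (cos (t * x) * gauss_kernel t)).
  have D1 := is_derive_gauss_kernel t; have D2 := is_derive_sinM t x.
  by apply: is_derive_eq; rewrite /GRing.scale/=; ring.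
have cc : continuous (fun t => t * sin (t * x) * gauss_kernel t - x * (cos (t * x) * gauss_kernel t)).
  by move=> t; apply: cvgB; [exact: cS|exact: cxJ].
have NA : - A <= A by rewrite ge0_cp.
have := cint_derive NA D cc; rewrite cintB// cintZ; last exact: continuous_gauss_cos.
rewrite gauss_kernelN mulNr sinN -/(gauss_cos A x); lra.
Qed.

(** Up to a boundary term, gauss_cos A solves the equation y' = - x y of the
    Gaussian kernel: integrate the derivative of y exp (x^2 / 2) from 0 to x. *)
Lemma gauss_cos_approx A x : 0 <= A ->
  `|gauss_cos A x - gauss_cos A 0 * gauss_kernel x| <= 2 * `|x| * gauss_kernel A.
Proof.
move=> A0.
have H y : 0 <= y -> `|gauss_cos A y - gauss_cos A 0 * gauss_kernel y| <= 2 * y * gauss_kernel A.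
  move=> y0; pose f z := gauss_cos A z * expR (2^-1 * z ^+ 2).
  have D (z : R) : is_derive z 1 f (2 * gauss_kernel A * sin (A * z) * expR (2^-1 * z ^+ 2)).
    have D1 := gauss_cos_derive z A0; have D2 := is_derive_expq z 2^-1.
    rewrite gauss_sin_parts// in D1.
    by apply: is_derive_eq; rewrite /GRing.scale/=; field.
  have cf : {within `[0, y], continuous f}.
    by apply: continuous_subspaceT; exact: is_derive_continuous D.
  have [c] := MVT_segment y0 (fun z _ => D z) cf.
  rewrite in_itv/= => /andP[c0 cy]; rewrite /f expr0n/= mulr0 expR0 mulr1 subr0 => E.
  have ek : expR (2^-1 * y ^+ 2) * gauss_kernel y = 1.
    by rewrite /gauss_kernel -expRD mulNr subrr expR0.
  have -> : gauss_cos A y - gauss_cos A 0 * gauss_kernel y =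
      (gauss_cos A y * expR (2^-1 * y ^+ 2) - gauss_cos A 0) * gauss_kernel y.
    by rewrite mulrBl -mulrA ek mulr1.
  rewrite E !normrM (ger0_norm (gauss_kernel_ge0 _)) (ger0_norm (gauss_kernel_ge0 _)).
  rewrite (ger0_norm y0) (ger0_norm (expR_ge0 _)) ger0_norm//.
  have e1 : expR (2^-1 * c ^+ 2) * gauss_kernel y <= 1.
    rewrite -[leRHS]ek ler_wpM2r ?gauss_kernel_ge0// ler_expR ler_pM2l ?invr_gt0//.
    by rewrite ler_pXn2r ?nnegrE.
  have s1 : `|sin (A * c)| * (expR (2^-1 * c ^+ 2) * gauss_kernel y) <= 1.
    by rewrite mulr_ile1 ?sin_max// mulr_ge0 ?expR_ge0.
  have k0 : 0 <= 2 * y * gauss_kernel A by rewrite !mulr_ge0// gauss_kernel_ge0.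
  by have := ler_wpM2l k0 s1; lra.
have [x0|/ltW x0] := leP 0 x; first by rewrite (ger0_norm x0) H.
have := H (- x); rewrite oppr_ge0 => /(_ x0).
by rewrite gauss_cosN gauss_kernelN (ler0_norm x0).
Qed.

(** Outside [-B, B] the kernel is at most |t| / B times itself, and t times the
    kernel has a primitive. *)
Lemma gauss_cos_tail A B x : 0 < B -> B <= A ->
  `|gauss_cos A x - gauss_cos B x| <= 2 / B.
Proof.
move=> B0 BA; have cg := @continuous_gauss_cos x.
have NAB : - A <= - B by rewrite lerN2.
have NBB : - B <= B by rewrite ge0_cp// ltW.
rewrite /gauss_cos (cint_cat cg NAB (le_trans NBB BA)) (cint_cat cg NBB BA).
have Bk (t : R) : is_derive t 1 (fun t => - B^-1 * gauss_kernel t) (B^-1 * t * gauss_kernel t).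
  have D1 := is_derive_gauss_kernel t.
  by apply: is_derive_eq; rewrite /GRing.scale/=; ring.
have Nk (t : R) : is_derive t 1 (fun t => B^-1 * gauss_kernel t) (- (B^-1 * t * gauss_kernel t)).
  have D1 := is_derive_gauss_kernel t.
  by apply: is_derive_eq; rewrite /GRing.scale/=; ring.
have c1 : continuous (fun t => B^-1 * t * gauss_kernel t).
  move=> t; apply: cvgM; last exact: continuous_gauss_kernel.
  by apply: cvgM; [exact: cvg_cst|exact: cvg_id].
have c2 : continuous (fun t => - (B^-1 * t * gauss_kernel t)).
  by move=> t; apply: cvgN; exact: c1.
have kb (t : R) : `|cos (t * x) * gauss_kernel t| <= gauss_kernel t.
  rewrite normrM (ger0_norm (gauss_kernel_ge0 t)) ler_piMl ?gauss_kernel_ge0//.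
  exact: cos_max.
have kAB : 0 <= gauss_kernel A <= gauss_kernel B.
  rewrite gauss_kernel_ge0 /= ler_expR !mulNr lerN2 ler_pM2l ?invr_gt0//.
  by rewrite ler_pXn2r ?nnegrE ?(le_trans (ltW B0))// ltW.
have Bi : 0 < B^-1 by rewrite invr_gt0.
have k1 := gauss_kernel_le1 B.
have Bk1 : B^-1 * gauss_kernel B <= B^-1 by rewrite ler_piMr// ltW.
have BkA : 0 <= B^-1 * gauss_kernel A by apply: mulr_ge0; [exact: ltW|exact: gauss_kernel_ge0].
have I1 : `|cint B A (fun t => cos (t * x) * gauss_kernel t)| <= B^-1.
  apply: (@le_trans _ _ (cint B A (fun t => B^-1 * t * gauss_kernel t))).
    apply: cint_normr_le => // t /andP[Bt _]; apply: le_trans (kb t) _.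
    by rewrite ler_peMl ?gauss_kernel_ge0// ler_pdivlMl// mulr1.
  by rewrite (cint_derive BA Bk c1); lra.
have I2 : `|cint (- A) (- B) (fun t => cos (t * x) * gauss_kernel t)| <= B^-1.
  apply: (@le_trans _ _ (cint (- A) (- B) (fun t => - (B^-1 * t * gauss_kernel t)))).
    apply: cint_normr_le => // t /andP[_ tB]; apply: le_trans (kb t) _.
    by rewrite -mulNr ler_peMl ?gauss_kernel_ge0// -mulrN ler_pdivlMl// mulr1 lerNr.
  by rewrite (cint_derive NAB Nk c2) !gauss_kernelN; lra.
have -> : 2 / B = B^-1 + B^-1 by rewrite mulr_natl mulr2n.
set u := cint (- A) (- B) _ in I2 *; set v := cint (- B) B _; set w := cint B A _ in I1 *.
have -> : u + (v + w) - v = u + w by ring.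
by apply: le_trans (ler_normD _ _) _; exact: lerD.
Qed.

Lemma integral_gauss_kernel :
  (\int[mu]_x (gauss_kernel x)%:E)%E = (Num.sqrt (2 * pi))%:E.
Proof.
have s0 : 0 < Num.sqrt (2 * pi) :> R by rewrite sqrtr_gt0 mulr_gt0// pi_gt0.
have kE x : gauss_kernel x = Num.sqrt (2 * pi) * normal_pdf 0 1 x.
  rewrite normal_pdfE ?oner_eq0// /normal_peak expr1n mul1r -[pi *+ 2]mulr_natl.
  rewrite mulrA divff ?gt_eqF// mul1r /normal_fun /gauss_kernel subr0 expr1n.
  by congr expR; field.
under eq_integral do rewrite kE EFinM.
rewrite integralZl//; last exact: integrable_normal_pdf.
by rewrite integral_normal_pdf mule1.
Qed.

Lemma gauss_cos0_cvg : gauss_cos n%:R 0 @[n --> \oo] --> (Num.sqrt (2 * pi) : R).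
Proof.
pose F n : set (measurableTypeR R) := `[- n%:R, n%:R]%classic.
have nndF : nondecreasing_seq F.
  move=> m n mn; rewrite subsetEset; apply: subset_itv; rewrite bnd_simp ?lerN2 ler_nat//.
have mF n : measurable (F n) by exact: measurable_itv.
have mk := fun n : nat => measurable_int mu
  (@cint_integrable _ (- n%:R) n%:R _ continuous_gauss_kernel).
have := @ge0_nondecreasing_set_cvg_integral _ (measurableTypeR R) R F (EFin \o gauss_kernel) mu nndF mF
  mk (fun i x _ => gauss_kernel_ge0 x).
have -> : \bigcup_i F i = setT.
  apply/seteqP; split => // x _; exists (Num.truncn `|x|).+1 => //.
  rewrite /F /= in_itv /= -ler_norml ltW//; exact: truncnS_gt.
rewrite integral_gauss_kernel => /fine_cvg; apply: cvg_trans.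
apply: near_eq_cvg; apply: nearW => n; rewrite /gauss_cos /cint /Rintegral /=.
by congr fine; apply: eq_integral => t _; rewrite mulr0 cos0 mul1r.
Qed.

(** Compare gauss_cos A x with gauss_cos n x for a large n, then gauss_cos n x with
    the multiple gauss_cos n 0 of the kernel, and gauss_cos n 0 with its
    limit. *)
Lemma gauss_cos_le A x : 0 < A ->
  `|gauss_cos A x - Num.sqrt (2 * pi) * gauss_kernel x| <= 2 / A.
Proof.
move=> A0; apply/ler_addgt0Pr => e e0.
have e2 : 0 < e / 2 by rewrite divr_gt0.
have /cvgrPdist_le/(_ _ e2)[N _ hN] := gauss_cos0_cvg.
pose n := maxn N (Num.truncn (A + 8 * `|x| / e)).+1.
have nA : A + 8 * `|x| / e <= n%:R.
  by apply: (le_trans (ltW (truncnS_gt _))); rewrite ler_nat leq_maxr.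
have x0 : 0 <= 8 * `|x| / e by rewrite divr_ge0 ?mulr_ge0// ltW.
have n0 : 0 < n%:R :> R by lra.
have h1 := gauss_cos_tail x A0 (_ : A <= n%:R); have {}h1 := h1 ltac:(lra).
have h2 := gauss_cos_approx x (ltW n0).
have h3 := hN n (leq_maxl _ _).
have kn : gauss_kernel n%:R <= 2 / n%:R.
  have : 1 + 2^-1 * n%:R ^+ 2 <= expR (2^-1 * n%:R ^+ 2) :> R by exact: expR_ge1Dx.
  rewrite /gauss_kernel mulNr expRN => h.
  have n20 : 0 < 2^-1 * n%:R ^+ 2 :> R by rewrite mulr_gt0// exprn_gt0.
  rewrite -[2 / _]invf_div lef_pV2 ?posrE ?divr_gt0 ?expR_gt0//.
  by apply: le_trans h; have := sqr_ge0 (n%:R - 1 :> R); lra.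
have h4 : 2 * `|x| * gauss_kernel n%:R <= e / 2.
  apply: (@le_trans _ _ (2 * `|x| * (2 / n%:R))); first by rewrite ler_wpM2l// mulr_ge0.
  rewrite mulrA ler_pdivrMr//; have : 8 * `|x| / e <= n%:R by lra.
  by rewrite ler_pdivrMr//; lra.
have h5 : `|(Num.sqrt (2 * pi) - gauss_cos n%:R 0) * gauss_kernel x| <= e / 2.
  rewrite normrM (ger0_norm (gauss_kernel_ge0 _)); apply: le_trans h3.
  by rewrite ler_piMr// gauss_kernel_le1.
set a := gauss_cos A x in h1 *; set b := gauss_cos n%:R x in h1 h2.
set c := gauss_cos n%:R 0 * gauss_kernel x in h2; rewrite mulrBl -/c in h5.
set d := Num.sqrt (2 * pi) * gauss_kernel x in h5 *.
move: h1 h2 h4 h5; rewrite !ler_norml => /andP[? ?] /andP[? ?] ? /andP[? ?].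
by apply/andP; split; lra.
Qed.

End GaussFourier.

(** * The law of a sum of independent Bernoulli variables *)

Section BernoulliLaw.
Context {R : realType} {d : measure_display} {T : measurableType d}.
Variable P : probability T R.
Implicit Types (E A : set T) (f : R -> R).

(** The hypotheses on the measures make A0 and A1 exhaust E up to a null set. *)
Lemma integral_setI_split E A0 A1 (h : T -> R) (p : R) :
  measurable E -> measurable A0 -> measurable A1 -> A0 `&` A1 = set0 ->
  measurable_fun setT h ->
  P (E `&` A1) = (p%:E * P E)%E -> P (E `&` A0) = ((1 - p)%:E * P E)%E ->
  (\int[P]_(t in E) (h t)%:E =
   \int[P]_(t in E `&` A1) (h t)%:E + \int[P]_(t in E `&` A0) (h t)%:E)%E.
Proof.
move=> mE mA0 mA1 A01 mh PE1 PE0.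
pose N := E `&` ~` (A0 `|` A1).
have mE1 : measurable (E `&` A1) by exact: measurableI.
have mE0 : measurable (E `&` A0) by exact: measurableI.
have mN : measurable N by apply: measurableI => //; apply: measurableC; exact: measurableU.
have EE : E = (E `&` A1) `|` ((E `&` A0) `|` N).
  apply/seteqP; split => t /=; last by move=> [[]//|[[]//|[]]].
  by move=> Et; have [A1t|nA1] := pselect (A1 t); [left|right];
    have [A0t|nA0] := pselect (A0 t); [ | |left|right; split => // -[]].
have d0N : (E `&` A0) `&` N = set0.
  by apply/seteqP; split => t //= [[_ A0t] [_ nA]]; apply: nA; left.
have d1 : (E `&` A1) `&` ((E `&` A0) `|` N) = set0.
  apply/seteqP; split => t //= [[_ A1t] [[_ A0t]|[_ nA]]].
    by have : (A0 `&` A1) t by []; rewrite A01.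
  by apply: nA; right.
have PN : P N = 0%E.
  have : P E = (P (E `&` A1) + (P (E `&` A0) + P N))%E.
    by rewrite {1}EE measureU ?measureU//; exact: measurableU.
  rewrite PE1 PE0.
  have /fineK <- : P E \is a fin_num by exact: fin_num_measure.
  have /fineK <- : P N \is a fin_num by exact: fin_num_measure.
  rewrite -!EFinM -!EFinD => -[] E0; congr EFin; lra.
have mhE B : measurable_fun B (fun t => (h t)%:E).
  by apply/measurable_EFinP; exact: measurable_funTS.
rewrite {1}EE integral_setU//; last 2 first.
- exact: measurableU.
- by apply/disj_setPS; rewrite d1.
rewrite integral_setU//; last by apply/disj_setPS; rewrite d0N.
by rewrite (null_set_integral mN)// adde0.
Qed.

Variables (p : R) (I : set nat) (X : nat -> {RV P >-> R}).
Hypothesis bX : forall j, I j -> is_bernoulli p (X j).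
Hypothesis iX : mutually_independent I X.

Let atom (J : {fset nat}) (e : nat -> R) : set T :=
  \bigcap_(j in [set` J]) (X j @^-1` [set e j]).

Let atomE J e : [set` J] `<=` I -> P (atom J e) = (\prod_(j <- J) P (X j @^-1` [set e j]))%E.
Proof. by move=> JI; apply: iX. Qed.

Let measurable_atom J e : measurable (atom J e).
Proof.
exact: bigcap_measurableType.
Qed.

(** On the event that the variables in J have the values given by e, the remaining
    ones are still independent Bernoulli variables.  The induction on r moves the
    variables one by one from r to J. *)
Lemma integral_atom (a : nat -> R) (r : seq nat) (J : {fset nat}) (e : nat -> R) f :
  uniq r -> (forall j, j \in r -> I j /\ j \notin J) -> [set` J] `<=` I ->
  measurable_fun setT f ->
  (\int[P]_(t in atom J e) (f (\sum_(j <- r) a j * X j t))%:E =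
   (bernE p [seq a j | j <- r] f)%:E * P (atom J e))%E.
Proof.
elim: r J e f => [|j r IH] J e f.
  move=> _ _ JI mf.
  under eq_integral do rewrite big_nil.
  by rewrite integral_cst; last exact: measurable_atom.
move=> /= /andP[jr ur] rIJ JI mf.
have [Ij jJ] : I j /\ j \notin J by apply: rIJ; exact: mem_head.
(* the values e, with the variable X j fixed to b *)
pose e' b i := if i == j then b else e i.
pose A b : set T := X j @^-1` [set b].
have JI' : [set` (j |` J)%fset] `<=` I.
  by move=> i /=; rewrite in_fset1U => /orP[/eqP ->//|]; exact: JI.
have rIJ' i : i \in r -> I i /\ i \notin (j |` J)%fset.
  move=> ir; have [Ii iJ] := rIJ i (mem_behead (s := j :: r) ir).
  split => //; rewrite in_fset1U negb_or iJ andbT.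
  by apply: contraNneq jr => <-.
have eJ b i : i \in J -> e' b i = e i.
  by rewrite /e'; case: eqP => // -> /(negP jJ).
have atomS b : atom J e `&` A b = atom (j |` J)%fset (e' b).
  apply/seteqP; split => t /=.
    move=> [Jt Ab] i /=; rewrite in_fset1U => /orP[/eqP ->|iJ].
      by rewrite /e' eqxx.
    by rewrite eJ//; exact: Jt.
  move=> Jt; split; last first.
    by have := Jt j; rewrite /= fset1U1 /e' eqxx; apply.
  by move=> i /= iJ; have := Jt i; rewrite /= in_fset1U iJ orbT eJ//; apply.
have PS b : P (atom J e `&` A b) = (P (A b) * P (atom J e))%E.
  rewrite atomS !atomE// big_fsetU1//=; congr (_ * _)%E.
    by rewrite /e' eqxx.
  by rewrite !big_seq; apply: eq_bigr => i iJ; rewrite eJ.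
have [P1 P0] := bX Ij.
have mA b : measurable (A b).
  by rewrite /A -[_ @^-1` _]setTI; apply: measurable_funP.
have A01 : A 0 `&` A 1 = set0.
  apply/seteqP; split => t //=; rewrite /A /= => -[X0 X1].
  by have := oner_neq0 R; rewrite -X1 X0 eqxx.
have mS : measurable_fun setT (fun t => \sum_(i <- r) a i * X i t).
  by apply: measurable_sum => i; apply: measurable_funM.
have mf' (c : R) : measurable_fun setT (fun x => f (c + x)).
  by apply: (measurableT_comp mf); apply: measurable_funD.
have mh : measurable_fun setT (fun t => f (\sum_(i <- j :: r) a i * X i t)).
  apply: (measurableT_comp mf); apply: measurable_sum => i; exact: measurable_funM.
rewrite (@integral_setI_split _ (A 0) (A 1) _ p)//; last 2 first.
- by rewrite PS P1.
- by rewrite PS P0.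
have step b g : (forall y, f (a j * b + y) = g y) -> measurable_fun setT g ->
    (\int[P]_(t in atom J e `&` A b) (f (\sum_(i <- j :: r) a i * X i t))%:E =
     (bernE p [seq a i | i <- r] g)%:E * P (atom J e `&` A b))%E.
  move=> fg mg; rewrite atomS -IH//; apply: eq_integral => t /set_mem tA.
  have -> : f (\sum_(i <- j :: r) a i * X i t) = g (\sum_(i <- r) a i * X i t).
    rewrite big_cons -fg; congr (f (_ * _ + _)).
    by have := tA j; rewrite /= fset1U1 /e' eqxx; apply.
  by [].
rewrite (step 1 (fun y => f (a j + y)))//; last by move=> y; rewrite mulr1.
rewrite (step 0 f)//; last by move=> y; rewrite mulr0 add0r.
rewrite !PS P1 P0.
have /fineK <- : P (atom J e) \is a fin_num by exact: fin_num_measure.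
by rewrite -!EFinM -EFinD; congr EFin; ring.
Qed.

Lemma integral_bernE (a : nat -> R) (r : seq nat) f :
  uniq r -> (forall j, j \in r -> I j) -> measurable_fun setT f ->
  (\int[P]_t (f (\sum_(j <- r) a j * X j t))%:E = (bernE p [seq a j | j <- r] f)%:E)%E.
Proof.
move=> ur rI mf.
have at0 : atom fset0 (fun=> 0) = setT.
  by apply/seteqP; split => t // _ i /=; rewrite in_fset0.
have := @integral_atom a r fset0 (fun=> 0) f ur.
rewrite at0 probability_setT mule1; apply => //.
by move=> j /rI Ij; split => //; rewrite in_fset0.
Qed.

Section Moments.
Variables (a : nat -> R) (r : seq nat).
Hypotheses (ur : uniq r) (rI : forall j, j \in r -> I j).
Let S (t : T) : R := \sum_(j <- r) a j * X j t.
Let s := [seq a j | j <- r].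

Lemma expectation_bernoulli_sum : fine ('E_P[S])%E = p * \sum_(x <- s) x.
Proof. by rewrite unlock (integral_bernE a ur rI (f := id))//= bernE_id. Qed.

Lemma variance_bernoulli_sum : fine ('V_P[S])%E = p * (1 - p) * \sum_(x <- s) x ^+ 2.
Proof.
rewrite /variance covariance.unlock; set c := fine ('E_P[S])%E.
have cE : c = p * \sum_(x <- s) x by exact: expectation_bernoulli_sum.
rewrite unlock.
have := integral_bernE a ur rI (f := fun x => (x - c) ^+ 2).
rewrite bernE_sqr -cE subrr expr0n/= addr0 => H.
transitivity (fine (p * (1 - p) * (\sum_(x <- s) x ^+ 2))%:E); last by [].
congr fine; rewrite -H; last by apply: measurable_funX; exact: measurable_funB.
by apply: eq_integral => t _; rewrite /= expr2.
Qed.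

Lemma prob_bernoulli_sum (m : R) :
  fine (P [set t | S t = m]) = bernE p s (fun x => (x == m)%:R).
Proof.
have mS : measurable_fun setT S.
  by apply: measurable_sum => i; apply: measurable_funM.
have mB : measurable [set t | S t = m].
  have := mS measurableT [set m] (measurable_set1 _).
  by rewrite setTI.
have mi : measurable_fun setT (fun x : R => (x == m)%:R : R).
  have -> : (fun x : R => (x == m)%:R : R) = \1_[set m].
    by apply/funext => x; rewrite indicE; congr (nat_of_bool _)%:R; apply/eqP/idP => [/mem_set|/set_mem].
  exact: measurable_indic.
have := integral_bernE a ur rI mi.
have -> : (\int[P]_t ((\sum_(j <- r) a j * X j t == m)%:R)%:E = P [set t | S t = m])%E.
  rewrite -[in RHS](setIT [set t | S t = m]) -integral_indic//.
  by apply: eq_integral => t _; rewrite indicE; congr ((nat_of_bool _)%:R)%:E; apply/eqP/idP => [/mem_set|/set_mem].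
by move=> ->.
Qed.

End Moments.
End BernoulliLaw.

(** * Fourier inversion on a lattice *)

Section LocalLimit.
Context {R : realType}.

Lemma cint_abs_gauss (B : R) : 0 <= B ->
  cint (- B) B (fun t => `|t| * expR (- 6^-1 * t ^+ 2)) <= 6.
Proof.
move=> B0; have NB : - B <= 0 by rewrite oppr_le0.
have D (t : R) : is_derive t 1 (fun t => - 3 * expR (- 6^-1 * t ^+ 2)) (t * expR (- 6^-1 * t ^+ 2)).
  have D1 := is_derive_expq t (- 6^-1).
  by apply: is_derive_eq; rewrite /GRing.scale/=; field.
have N (t : R) : is_derive t 1 (fun t => 3 * expR (- 6^-1 * t ^+ 2)) (- (t * expR (- 6^-1 * t ^+ 2))).
  have D1 := is_derive_expq t (- 6^-1).
  by apply: is_derive_eq; rewrite /GRing.scale/=; field.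
have ce : continuous (fun t : R => expR (- 6^-1 * t ^+ 2)).
  by apply: is_derive_continuous => t; exact: is_derive_expq.
have c1 : continuous (fun t : R => t * expR (- 6^-1 * t ^+ 2)).
  by move=> t; apply: cvgM; [exact: cvg_id|exact: ce].
have c2 : continuous (fun t : R => - (t * expR (- 6^-1 * t ^+ 2))).
  by move=> t; apply: cvgN; exact: c1.
have ca : continuous (fun t : R => `|t| * expR (- 6^-1 * t ^+ 2)).
  by move=> t; apply: cvgM; [exact: norm_continuous|exact: ce].
rewrite (cint_cat ca NB B0).
rewrite (@eq_cint _ (- B) 0 _ (fun t => - (t * expR (- 6^-1 * t ^+ 2)))); last first.
  by move=> t /andP[_ t0]; rewrite ler0_norm// mulNr.
rewrite (@eq_cint _ 0 B _ (fun t => t * expR (- 6^-1 * t ^+ 2))); last first.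
  by move=> t /andP[t0 _]; rewrite ger0_norm.
rewrite (cint_derive NB N c2) (cint_derive B0 D c1) expr0n/= mulr0 expR0.
by have := expR_ge0 (- 6^-1 * B ^+ 2); have := expR_ge0 (- 6^-1 * (- B) ^+ 2); lra.
Qed.

(** If r |t| <= exp (- t^2 / 12) use the first bound, otherwise the second one.
    Its weights 1/3 and 2/3 turn r^3, of the order of (p n)^(-1/2), into r, whence
    the exponent -1/6 of the theorem. *)
Lemma geometric_mean_bound (K r t D : R) : 1 <= K -> 0 <= r ->
  D <= 2 * K * r ^+ 3 * `|t| ^+ 3 -> D <= 2 * expR (- 4^-1 * t ^+ 2) ->
  D <= 2 * K * r * (`|t| * expR (- 6^-1 * t ^+ 2)).
Proof.
move=> K1 r0 h1 h2; set e := expR (- 12^-1 * t ^+ 2).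
have e0 : 0 <= e by exact: expR_ge0.
have E6 : expR (- 6^-1 * t ^+ 2) = e ^+ 2.
  by rewrite [RHS]expr2 -expRD; congr expR; field.
have E4 : expR (- 4^-1 * t ^+ 2) = e ^+ 3.
  by rewrite [RHS]exprS [e ^+ 2]expr2 -!expRD; congr expR; field.
rewrite E6; rewrite E4 in h2; set u := r * `|t|.
have u0 : 0 <= u by rewrite mulr_ge0.
have -> : 2 * K * r * (`|t| * e ^+ 2) = 2 * K * (u * e ^+ 2) by rewrite /u; ring.
have [ue|eu] := leP u e.
  apply: (le_trans h1); have -> : 2 * K * r ^+ 3 * `|t| ^+ 3 = 2 * K * (u * u ^+ 2) by rewrite /u; ring.
  rewrite ler_wpM2l//; first by rewrite mulr_ge0//; lra.
  by rewrite ler_wpM2l// ler_pXn2r ?nnegrE.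
apply: (le_trans h2); rewrite exprS -mulrA ler_pM2l//.
have ee : e * e ^+ 2 <= u * e ^+ 2 by rewrite ler_wpM2r ?exprn_ge0// ltW.
by apply: (le_trans ee); rewrite ler_peMl// mulr_ge0// exprn_ge0.
Qed.

(** For x in g Z the frequency of the cosine makes its integral vanish unless
    x = m, since sin (pi l) = 0 for every integer l. *)
Lemma bernE_inversion (p : R) (s : seq R) (g m : int) (sg : R) :
  0 < g -> 0 < sg -> (g %| m)%Z ->
  (forall a, a \in s -> exists l : int, a = (l * g)%:~R) ->
  sg / g%:~R * bernE p s (fun x => (x == m%:~R)%:R) =
  (2 * pi)^-1 * cint (- (pi * sg / g%:~R)) (pi * sg / g%:~R)
    (fun t => bernE p s (fun x => cos (t * ((x - m%:~R) / sg)))).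
Proof.
move=> g0 sg0 /dvdzP[m' mE] sl; set B := pi * sg / g%:~R.
have pi0 := pi_gt0 R; have gR0 : 0 < g%:~R :> R by rewrite ltr0z.
have B0 : 0 < B by rewrite divr_gt0// mulr_gt0.
rewrite -(@bernE_cint _ p s (- B) B (fun t x => cos (t * ((x - m%:~R) / sg)))); last first.
  by move=> x; exact: continuous_cosM.
rewrite -(bernE_scale p s (sg / g%:~R)) -(bernE_scale p s (2 * pi)^-1).
apply: (@bernE_eq_in _ _ (fun x => exists l : int, x = (l * g)%:~R)).
- by exists 0; rewrite mul0r.
- by move=> a /sl[l ->] x [l' ->]; exists (l + l'); rewrite mulrDl intrD.
move=> x [l ->]; have [E|E] := eqVneq ((l * g)%:~R : R) m%:~R.
  rewrite E subrr mul0r (@eq_cint _ _ _ _ (fun=> 1)); last first.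
    by move=> t _; rewrite mulr0 cos0.
  rewrite cint_cst ?ge0_cp ?(ltW B0)//.
  have aux (q u v : R) : q != 0 -> v != 0 ->
      u / v * 1 = (2 * q)^-1 * (1 * (q * u / v - - (q * u / v))).
    by move=> q0 v0; field; rewrite q0 v0.
  by apply: aux; rewrite gt_eqF.
rewrite mulr0 cint_cos//; last first.
  by rewrite mulf_eq0 invr_eq0 subr_eq0 (negbTE E) gt_eqF.
have -> : B * (((l * g)%:~R - m%:~R) / sg) = pi * (l - m')%:~R.
  rewrite mE !intrM intrB /B.
  have aux (q u v c e : R) : u != 0 -> v != 0 ->
      q * u / v * ((c * v - e * v) / u) = q * (c - e).
    by move=> u0 v0; field; rewrite u0 v0.
  by apply: aux; rewrite gt_eqF.
by rewrite sin_pi_int mulr0 mul0r mulr0.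
Qed.

Lemma local_limit_of_pointwise (p : R) (s : seq R) (g m : int) (sg mu E r : R) :
  0 < g -> 0 < sg -> (g %| m)%Z ->
  (forall a, a \in s -> exists l : int, a = (l * g)%:~R) ->
  0 <= E -> 0 <= r ->
  let B := pi * sg / g%:~R in
  let z := (m%:~R - mu) / sg in
  (forall t, `|t| <= B ->
    `|bernE p s (fun x => cos (t * ((x - m%:~R) / sg))) - cos (t * z) * gauss_kernel t|
      <= r * (`|t| * expR (- 6^-1 * t ^+ 2)) + E) ->
  `|sg / g%:~R * bernE p s (fun x => (x == m%:~R)%:R) - std_gauss z| <=
    6 * r + 2 * B * E + 2 / B.
Proof.
move=> g0 sg0 gm sl E0 r0 B z H.
have pi2 := pi_ge2 R; have gR0 : 0 < g%:~R :> R by rewrite ltr0z.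
have B0 : 0 < B by rewrite divr_gt0// mulr_gt0// pi_gt0.
rewrite (bernE_inversion p g0 sg0 gm sl) -/B.
set f := fun t => bernE p s _; set h := fun t => cos (t * z) * gauss_kernel t.
have cf : continuous f.
  apply: (@bernE_continuous _ p s (fun t x => cos (t * ((x - m%:~R) / sg)))) => x.
  exact: continuous_cosM.
have ch : continuous h by exact: continuous_gauss_cos.
have ce : continuous (fun t : R => `|t| * expR (- 6^-1 * t ^+ 2)).
  have cq : continuous (fun t : R => expR (- 6^-1 * t ^+ 2)).
    by apply: is_derive_continuous => u; exact: is_derive_expq.
  by move=> t; apply: cvgM; [exact: norm_continuous|exact: cq].
have cre : continuous (fun t : R => r * (`|t| * expR (- 6^-1 * t ^+ 2))).
  by move=> t; apply: cvgM; [exact: cvg_cst|exact: ce].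
have cE : continuous (fun t : R => E) by move=> t; exact: cvg_cst.
have I1 : `|cint (- B) B f - gauss_cos B z| <= 6 * r + 2 * B * E.
  rewrite /gauss_cos -cintB//.
  apply: (@le_trans _ _ (cint (- B) B (fun t => r * (`|t| * expR (- 6^-1 * t ^+ 2)) + E))).
    apply: cint_normr_le.
    - by move=> t; apply: cvgB; [exact: cf|exact: ch].
    - by move=> t; apply: cvgD; [exact: cre|exact: cE].
    - by move=> t tB; apply: H; rewrite ler_norml.
  rewrite cintD// cintZ// cint_cst ?ge0_cp ?(ltW B0)//.
  by have := ler_wpM2l r0 (cint_abs_gauss (ltW B0)); lra.
have I2 := gauss_cos_le z B0.
have -> : std_gauss z = (2 * pi)^-1 * (Num.sqrt (2 * pi) * gauss_kernel z).
  have s0 : 0 < Num.sqrt (2 * pi) :> R by rewrite sqrtr_gt0 mulr_gt0// pi_gt0.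
  rewrite /std_gauss /gauss_kernel mulrA; congr (_ * _).
    have s2 : 2 * pi = Num.sqrt (2 * pi) ^+ 2 :> R.
      by rewrite sqr_sqrtr// mulr_ge0// pi_ge0.
    by rewrite {2}s2 expr2 invfM -mulrA mulVf ?mulr1// gt_eqF.
  by congr expR; field.
rewrite -mulrBr normrM ger0_norm; last by rewrite invr_ge0 mulr_ge0// pi_ge0.
apply: (@le_trans _ _ (1 * `|cint (- B) B f - Num.sqrt (2 * pi) * gauss_kernel z|)).
  by rewrite ler_wpM2r// invf_le1; lra.
rewrite mul1r -(subrKA (gauss_cos B z)); apply: le_trans (ler_normD _ _) _.
exact: lerD.
Qed.

End LocalLimit.

(** * Characteristic functions of the sums *)

Section Pointwise.
Context {R : realType}.

Lemma sin_sqr_lb (v : R) : `|v| <= 2^-1 -> v ^+ 2 / 2 <= sin v ^+ 2.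
Proof.
have H (u : R) : 0 <= u -> u <= 2^-1 -> u ^+ 2 / 2 <= sin u ^+ 2.
  move=> u0 u1; have := sin_ge_cubic u0.
  have u2 : u ^+ 2 <= 4^-1 by rewrite expr2; nra.
  have u3 : u ^+ 3 <= u / 4 by rewrite exprS; nra.
  move=> h; have h' : 23 / 24 * u <= sin u by lra.
  have : (23 / 24 * u) ^+ 2 <= sin u ^+ 2 by rewrite ler_pXn2r ?nnegrE//; lra.
  by have := sqr_ge0 u; rewrite exprMn; lra.
move=> v2; have := H `|v| (normr_ge0 _) v2; rewrite real_normK ?num_real//.
by have [v0|v0] := leP 0 v; rewrite ?(ger0_norm v0) ?(ltr0_norm v0) ?sinN ?sqrrN.
Qed.

Variables (p : R) (s : seq R) (sg M : R).
Hypotheses (p0 : 0 < p) (p2 : p <= 2^-1) (sg0 : 0 < sg) (M0 : 0 < M).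
Hypothesis sgE : sg ^+ 2 = p * (1 - p) * \sum_(a <- s) a ^+ 2.
Hypothesis sM : forall a, a \in s -> `|a| <= M.

Let p01 : 0 <= p <= 1. Proof. by rewrite (ltW p0) /=; have := p2; lra. Qed.

Let mu := p * \sum_(a <- s) a.

(** Bounding |a|^3 by M a^2 reduces the third moments to the variance. *)
Lemma bernE_clt_bound (t be : R) :
  `|bernE p s (fun x => cos (t / sg * (x - mu) + be)) - cos be * gauss_kernel t| <=
  4 * (M / sg) * `|t| ^+ 3.
Proof.
have := bernE_gauss p01 s (t / sg) be.
have -> : expR (- (p * (1 - p) * (\sum_(a <- s) a ^+ 2) * (t / sg) ^+ 2 / 2)) = gauss_kernel t.
  by rewrite -sgE; congr expR; field; rewrite gt_eqF.
rewrite -/mu => h; rewrite [cos be * _]mulrC.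
apply: (le_trans h); rewrite normrM normfV (gtr0_norm sg0).
have S3 : \sum_(a <- s) `|a| ^+ 3 <= M * \sum_(a <- s) a ^+ 2.
  rewrite mulr_sumr !big_seq; apply: ler_sum => a /sM aM.
  by rewrite exprS real_normK ?num_real// ler_wpM2r ?sqr_ge0.
have V0 : 0 <= \sum_(a <- s) a ^+ 2 by rewrite sumr_ge0// => a _; exact: sqr_ge0.
have pS3 : p * \sum_(a <- s) `|a| ^+ 3 <= 2 * M * sg ^+ 2.
  apply: (@le_trans _ _ (p * (M * \sum_(a <- s) a ^+ 2))); first by rewrite ler_wpM2l// ltW.
  rewrite sgE; have MV : 0 <= M * \sum_(a <- s) a ^+ 2 by rewrite mulr_ge0// ltW.
  set W := M * _ in MV *; have -> : 2 * M * (p * (1 - p) * \sum_(a <- s) a ^+ 2) = 2 * (1 - p) * (p * W).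
    by rewrite /W; ring.
  have pW : 0 <= p * W by apply: mulr_ge0; rewrite // ltW.
  by rewrite ler_peMl//; have := p2; lra.
apply: (@le_trans _ _ (2 * (`|t| * sg^-1) ^+ 3 * (2 * M * sg ^+ 2))).
  by rewrite ler_wpM2l// mulr_ge0// exprn_ge0// mulr_ge0// invr_ge0 ltW.
by rewrite le_eqVlt; apply/orP; left; apply/eqP; field; rewrite gt_eqF.
Qed.

Lemma bernE_cos_major (t be : R) : `|t| * M <= sg ->
  `|bernE p s (fun x => cos (t / sg * x + be))| <= expR (- 4^-1 * t ^+ 2).
Proof.
move=> tM; rewrite -(@ler_pXn2r _ 2%N) ?nnegrE ?expR_ge0//.
rewrite real_normK ?num_real//; apply: (le_trans (bernE_cos_sqr_le p01 s _ be)).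
rewrite expr2 -expRD ler_expR.
suff : t ^+ 2 / 2 <= 4 * p * (1 - p) * \sum_(a <- s) sin (t / sg * a / 2) ^+ 2 by lra.
have q0 : 0 <= 4 * p * (1 - p) by rewrite mulr_ge0 ?mulr_ge0 ?(ltW p0)//; have := p2; lra.
have -> : t ^+ 2 / 2 = 4 * p * (1 - p) * ((t / sg) ^+ 2 / 8 * \sum_(a <- s) a ^+ 2).
  have -> : 4 * p * (1 - p) * ((t / sg) ^+ 2 / 8 * \sum_(a <- s) a ^+ 2) =
     (p * (1 - p) * (\sum_(a <- s) a ^+ 2)) * (t / sg) ^+ 2 / 2 by field; rewrite gt_eqF.
  by rewrite -sgE; field; rewrite gt_eqF.
rewrite ler_wpM2l// mulr_sumr !big_seq; apply: ler_sum => a /sM aM.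
have -> : (t / sg) ^+ 2 / 8 * a ^+ 2 = (t / sg * a / 2) ^+ 2 / 2 by field; rewrite gt_eqF.
apply: sin_sqr_lb; rewrite !normrM !normfV (gtr0_norm sg0) (ger0_norm (ler0n R 2)).
rewrite ler_pdivrMr// mulVf// mulrAC ler_pdivrMr// mul1r.
by apply: le_trans tM; rewrite ler_wpM2l.
Qed.

Lemma bernE_cos_minor (t be Q : R) :
  Q <= \sum_(a <- s) sin (t / sg * a / 2) ^+ 2 ->
  `|bernE p s (fun x => cos (t / sg * x + be))| <= expR (- (p * Q)).
Proof.
move=> QS; rewrite -(@ler_pXn2r _ 2%N) ?nnegrE ?expR_ge0//.
rewrite real_normK ?num_real//; apply: (le_trans (bernE_cos_sqr_le p01 s _ be)).
rewrite expr2 -expRD ler_expR; set W := \sum_(a <- s) _ in QS *.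
have W0 : 0 <= W by rewrite sumr_ge0// => a _; exact: sqr_ge0.
have pW : 0 <= p * W by rewrite mulr_ge0// ltW.
have : p * Q <= p * W by rewrite ler_wpM2l// ltW.
have : 2 * (p * W) <= 4 * p * (1 - p) * W.
  have -> : 4 * p * (1 - p) * W = 4 * (1 - p) * (p * W) by ring.
  by rewrite ler_wpM2r//; have := p2; lra.
by lra.
Qed.

End Pointwise.

(** * The local limit theorem for the Bernoulli mean *)

Section Main.
Context {R : realType}.

(** Powers with fractional exponents enter only through these three
    properties. *)
Lemma powR_sixth (nu : R) : 1 <= nu ->
  let r := nu `^ (- 6^-1) in [/\ 0 < r, r <= 1 & nu * r ^+ 6 = 1].
Proof.
move=> nu1 r; have nu0 : 0 < nu by lra.
have r6 : r ^+ 6 = nu^-1.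
  rewrite -powR_mulrn ?powR_ge0// -powRrM mulNr mulVf//.
  by rewrite powR_inv1// ltW.
have r0 : 0 < r by exact: powR_gt0.
split=> //; last by rewrite r6 mulfV// gt_eqF.
rewrite leNgt; apply/negP => r1.
have : 1 < r ^+ 6 by rewrite exprn_egt1.
by rewrite r6 ltNge invf_le1// nu1.
Qed.

Variable k : nat.
Hypothesis k2 : (2 <= k)%N.

Definition Fcoef (n : nat) : seq R :=
  [seq (Fint n%:Z k j%:Z)%:~R | j <- index_iota 1 n].

Definition bern_sigma (n : nat) (p : R) : R :=
  Num.sqrt (p * (1 - p) * \sum_(a <- Fcoef n) a ^+ 2).

Section FixedParams.
Variables (n : nat) (p : R).
Hypotheses (n8k : (8 * k <= n)%N) (pn : n%:R^-1 <= p) (p2 : p <= 2^-1).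

Let s := Fcoef n.
Let sg := bern_sigma n p.
Hypothesis sg0 : 0 < sg.
Variable Cv : R.
Hypothesis Cv1 : 1 <= Cv.
Hypothesis hV : n%:R ^+ (2 * k).+1 <= Cv * \sum_(a <- s) a ^+ 2.

Let Cv0 : 0 <= Cv. Proof. by apply: le_trans Cv1. Qed.
Let nu := p * n%:R.
Let r := nu `^ (- 6^-1).

Let n0 : 0 < n%:R :> R. Proof. by rewrite ltr0n; move: k2 n8k; lia. Qed.
Let p0 : 0 < p. Proof. by apply: lt_le_trans pn; rewrite invr_gt0. Qed.
Let nu1 : 1 <= nu. Proof. by rewrite /nu -ler_pdivrMr// mul1r. Qed.
Let V0 : 0 <= \sum_(a <- s) a ^+ 2.
Proof. by rewrite sumr_ge0// => a _; exact: sqr_ge0. Qed.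

Let sgE : sg ^+ 2 = p * (1 - p) * \sum_(a <- s) a ^+ 2.
Proof.
rewrite sqr_sqrtr// mulr_ge0// mulr_ge0 ?(ltW p0)//.
by have := p2; lra.
Qed.

Let nu_le_var : nu * n%:R ^+ (2 * k) <= 2 * Cv * sg ^+ 2.
Proof.
rewrite sgE /nu -mulrA -exprS; have := V0; have := hV.
set V := \sum_(a <- s) _ => hV' V0'.
apply: (@le_trans _ _ (p * (Cv * V))); first by rewrite ler_wpM2l// ltW.
have pCV : 0 <= p * (Cv * V) by apply: mulr_ge0; [exact: ltW|exact: mulr_ge0].
have -> : 2 * Cv * (p * (1 - p) * V) = 2 * (1 - p) * (p * (Cv * V)) by ring.
by rewrite ler_peMl//; have := p2; lra.
Qed.

Let coef_le a : a \in s -> `|a| <= 3 * n%:R ^+ k.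
Proof.
move=> /mapP[j]; rewrite mem_index_iota => /andP[_ jn] ->.
rewrite -intr_norm -[3]/(3%:~R) -[n%:R]/(n%:Z%:~R) -rmorphXn -intrM ler_int.
by apply: Fint_bound; [clear -k2 n8k; lia|clear -jn; lia].
Qed.

Let r_props : [/\ 0 < r, r <= 1 & nu * r ^+ 6 = 1].
Proof. exact: powR_sixth. Qed.

Let nk_le : n%:R ^+ (2 * k) <= 2 * Cv * sg ^+ 2 * r ^+ 6.
Proof.
have [r0 r1 r6] := r_props.
by have := ler_wpM2r (exprn_ge0 6 (ltW r0)) nu_le_var; rewrite mulrAC r6 mul1r.
Qed.

Let M_le : 3 * n%:R ^+ k <= 36 * Cv * r ^+ 3 * sg.
Proof.
have [r0 r1 _] := r_props; have cv1 := Cv1; have cv0 : 0 <= Cv by lra.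
rewrite -(@ler_pXn2r _ 2%N) ?nnegrE ?mulr_ge0 ?exprn_ge0 ?(ltW r0) ?(ltW sg0)//.
rewrite exprMn -exprM mulnC.
have -> : (36 * Cv * r ^+ 3 * sg) ^+ 2 = 1296 * Cv ^+ 2 * (sg ^+ 2 * r ^+ 6) by ring.
have sr : 0 <= sg ^+ 2 * r ^+ 6 by rewrite mulr_ge0 ?exprn_ge0 ?(ltW r0) ?(ltW sg0).
have nk := nk_le; have cc : 18 * Cv <= 1296 * Cv ^+ 2 by nra.
by have := ler_wpM2r sr cc; lra.
Qed.

Let n_le : n%:R <= 2 * Cv * r * sg.
Proof.
have [r0 r1 _] := r_props; have cv1 := Cv1; have cv0 : 0 <= Cv by lra.
rewrite -(@ler_pXn2r _ 2%N) ?nnegrE ?mulr_ge0 ?(ltW r0) ?(ltW sg0)//.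
apply: (@le_trans _ _ (n%:R ^+ (2 * k))).
  have n1 : 1 <= n%:R :> R by rewrite ler1n -(ltr0n R).
  by rewrite (ler_weXn2l n1) ?leq_pmulr// (ltn_trans _ k2).
apply: (le_trans nk_le).
have -> : (2 * Cv * r * sg) ^+ 2 = 4 * Cv ^+ 2 * (sg ^+ 2 * r ^+ 2) by ring.
have r62 : r ^+ 6 <= r ^+ 2 by rewrite ler_wiXn2l// ltW.
have sr : 0 <= sg ^+ 2 * r ^+ 2 by rewrite mulr_ge0 ?sqr_ge0.
have cc : 2 * Cv <= 4 * Cv ^+ 2 by nra.
apply: le_trans (ler_wpM2r sr cc); rewrite -mulrA ler_wpM2l ?mulr_ge0//.
by apply: ler_wpM2l; [exact: sqr_ge0|exact: r62].
Qed.

Let g := gcdF n%:Z k.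

Let g_bounds : 1 <= g%:~R :> R /\ g%:~R <= n%:R :> R.
Proof.
have /andP[g0 gn] := @gcdF_le n k k2 ltac:(clear -n8k; lia).
by split; [rewrite -[1]/(1%:~R) ler_int|rewrite -[n%:R]/(n%:Z%:~R) ler_int].
Qed.

Let mu := p * \sum_(a <- s) a.

(** The two terms on the right come from the frequencies with
    |t| max |F| <= sigma, where the central limit estimate applies, and from the
    other ones, where the bound on sin^2 sums makes both functions exponentially
    small. *)
Lemma pointwise_bound (e0 C1 c : R) (m : int) (t : R) : 0 < C1 ->
  (forall al : R, `|al| * (2 * g%:~R) <= 1 ->
    let Q := \sum_(1 <= j < n) sqsin (al * (Fint n%:Z k j%:Z)%:~R) in
    Q <= e0 * n%:R -> al ^+ 2 * n%:R ^+ (2 * k) * n%:R <= C1 * Q) ->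
  0 <= c -> c <= e0 -> c <= (576 * C1)^-1 -> c <= (36 * Cv)^-1 ->
  `|t| <= pi * sg / g%:~R ->
  `|bernE p s (fun x => cos (t * ((x - m%:~R) / sg)))
    - cos (t * ((m%:~R - mu) / sg)) * gauss_kernel t|
  <= 2 * (72 * Cv) * r * (`|t| * expR (- 6^-1 * t ^+ 2)) + 2 * expR (- (c * nu)).
Proof.
move=> C10 key c0 ce cC cCv tB.
have [r0 r1 r6] := r_props; have cv1 := Cv1; have pi0 := pi_gt0 R.
set z := (m%:~R - mu) / sg; set D := _ - _.
have M0 : 0 < 3 * n%:R ^+ k :> R by rewrite mulr_gt0// exprn_gt0.
have E1 : bernE p s (fun x => cos (t * ((x - m%:~R) / sg))) =
    bernE p s (fun x => cos (t / sg * (x - mu) + - (t * z))).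
  by apply: eq_bernE => x; congr cos; rewrite /z; field; rewrite gt_eqF.
have E2 : bernE p s (fun x => cos (t * ((x - m%:~R) / sg))) =
    bernE p s (fun x => cos (t / sg * x + - (t / sg * m%:~R))).
  by apply: eq_bernE => x; congr cos; field; rewrite gt_eqF.
have k0 := gauss_kernel_ge0 t.
have e_ge0 : 0 <= 2 * expR (- (c * nu)) by rewrite mulr_ge0// expR_ge0.
have g_ge0 : 0 <= 2 * (72 * Cv) * r * (`|t| * expR (- 6^-1 * t ^+ 2)).
  by rewrite !mulr_ge0 ?expR_ge0 ?(ltW r0).
have D2 u : `|bernE p s (fun x => cos (t * ((x - m%:~R) / sg)))| <= u ->
    gauss_kernel t <= u -> `|D| <= 2 * u.
  move=> bu ku; apply: le_trans (ler_normB _ _) _.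
  have : `|cos (t * z) * gauss_kernel t| <= gauss_kernel t.
    by rewrite normrM (ger0_norm k0) ler_piMl// cos_max.
  by lra.
have [tM|tM] := leP (`|t| * (3 * n%:R ^+ k)) sg.
  apply: (@le_trans _ _ (2 * (72 * Cv) * r * (`|t| * expR (- 6^-1 * t ^+ 2)))); last by lra.
  apply: geometric_mean_bound; [by lra|exact: ltW| |].
    rewrite /D E1 -[cos (t * z)]cosN.
    apply: le_trans (bernE_clt_bound p0 p2 sg0 M0 sgE coef_le t _) _.
    rewrite ler_wpM2r ?exprn_ge0// mulrA ler_pdivrMr//.
    by have := M_le; lra.
  apply: D2.
    by rewrite E2; apply: (@bernE_cos_major _ p s sg _ p0 p2 sg0 sgE coef_le).
  by rewrite /gauss_kernel ler_expR !mulNr lerN2 ler_wpM2r ?sqr_ge0//; lra.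
apply: (@le_trans _ _ (2 * expR (- (c * nu)))); last by lra.
have [g1 gn] := g_bounds; have g0 : 0 < g%:~R :> R by lra.
(* t / sg is the frequency 2 pi al of the exponential sum *)
pose al := t / sg / 2 / pi.
have alE : `|al| = `|t| / sg / 2 / pi.
  by rewrite /al !normrM !normfV (gtr0_norm sg0) (gtr0_norm pi0) (ger0_norm (ler0n R 2)).
have alg : `|al| * (2 * g%:~R) <= 1.
  have aux (q u v : R) : q != 0 -> u / sg / 2 / q * (2 * v) = u * v / sg / q.
    by move=> q0; field; rewrite q0 gt_eqF.
  rewrite alE aux ?gt_eqF//.
  rewrite ler_pdivrMr// mul1r ler_pdivrMr//.
  by move: tB; rewrite ler_pdivlMr.
have al2 : 1 <= 576 * (al ^+ 2 * n%:R ^+ (2 * k)).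
  have h1 : 1 <= 24 * (`|al| * n%:R ^+ k).
    have aux (q u v : R) : q != 0 ->
        24 * (u / sg / 2 / q * v) = 4 * (u * (3 * v) / sg) / q.
      by move=> q0; field; rewrite q0 gt_eqF.
    rewrite alE aux ?gt_eqF//.
    have h : 1 <= `|t| * (3 * n%:R ^+ k) / sg by rewrite ler_pdivlMr// mul1r ltW.
    rewrite ler_pdivlMr// mul1r; have := pihalf_lt2 R; lra.
  have : 1 ^+ 2 <= (24 * (`|al| * n%:R ^+ k)) ^+ 2.
    by rewrite ler_pXn2r ?nnegrE//; lra.
  have E : (`|al| * n%:R ^+ k) ^+ 2 = al ^+ 2 * n%:R ^+ (2 * k).
    by rewrite [LHS]exprMn real_normK ?num_real// -exprM (mulnC k).
  by rewrite expr1n (exprMn 2 24 (`|al| * n%:R ^+ k)) E; lra.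
have QE : \sum_(1 <= j < n) sqsin (al * (Fint n%:Z k j%:Z)%:~R) =
    \sum_(a <- s) sin (t / sg * a / 2) ^+ 2.
  rewrite /s /Fcoef big_map; apply: eq_bigr => j _; rewrite /sqsin; congr (sin _ ^+ 2).
  have aux (q a : R) : q != 0 -> q * (t / sg / 2 / q * a) = t / sg * a / 2.
    by move=> q0; field; rewrite q0 gt_eqF.
  by apply: aux; rewrite gt_eqF.
have Qlb : c * n%:R <= \sum_(a <- s) sin (t / sg * a / 2) ^+ 2.
  rewrite -QE; have := key al alg; set Q := \sum_(1 <= j < n) _ => /= keyQ.
  have [/keyQ h|h] := leP Q (e0 * n%:R); last first.
    by apply: le_trans (ltW h); rewrite ler_wpM2r// ltW.
  have h2 : n%:R <= 576 * C1 * Q.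
    by have := ler_wpM2r (ltW n0) al2; rewrite mul1r; lra.
  apply: (@le_trans _ _ ((576 * C1)^-1 * n%:R)); first by rewrite ler_wpM2r// ltW.
  have CC : 0 < 576 * C1 by lra.
  by rewrite (ler_pdivrMl _ _ CC).
apply: D2.
  rewrite E2; apply: le_trans (bernE_cos_minor p0 p2 _ Qlb) _.
  by rewrite /nu mulrCA.
rewrite /gauss_kernel ler_expR mulNr lerN2.
have nu_le : nu <= 18 * Cv * t ^+ 2.
  have n2k : 0 < n%:R ^+ (2 * k) :> R by rewrite exprn_gt0.
  rewrite -(ler_pM2r n2k); apply: (le_trans nu_le_var).
  have : sg ^+ 2 <= (`|t| * (3 * n%:R ^+ k)) ^+ 2.
    by rewrite ler_pXn2r ?nnegrE ?mulr_ge0 ?exprn_ge0 ?(ltW sg0)// ltW.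
  rewrite !exprMn real_normK ?num_real// -exprM (mulnC k) => h.
  have cv0 : 0 <= 2 * Cv by lra.
  by have := ler_wpM2l cv0 h; lra.
apply: (@le_trans _ _ ((36 * Cv)^-1 * nu)); first by rewrite ler_wpM2r//; have := nu1; lra.
have CC : 0 < 36 * Cv by lra.
by rewrite (ler_pdivrMl _ _ CC); lra.
Qed.

Lemma bern_local_limit_bound (e0 C1 c : R) (m : int) : 0 < C1 ->
  (forall al : R, `|al| * (2 * g%:~R) <= 1 ->
    let Q := \sum_(1 <= j < n) sqsin (al * (Fint n%:Z k j%:Z)%:~R) in
    Q <= e0 * n%:R -> al ^+ 2 * n%:R ^+ (2 * k) * n%:R <= C1 * Q) ->
  0 <= c -> c <= e0 -> c <= (576 * C1)^-1 -> c <= (36 * Cv)^-1 ->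
  (g %| m)%Z ->
  `|sg / g%:~R * bernE p s (fun x => (x == m%:~R)%:R) - std_gauss ((m%:~R - mu) / sg)|
  <= (12 * (72 * Cv) + 16 + 2 * Cv) * (r + sg * expR (- (c * nu))).
Proof.
move=> C10 key c0 ce cC cCv gm.
have [r0 r1 r6] := r_props; have cv1 := Cv1; have pi2 := pi_ge2 R.
have pi4 := pihalf_lt2 R; have [g1 gn] := g_bounds.
have g0 : 0 < g%:~R :> R by lra.
set e := expR (- (c * nu)); have e_ge0 : 0 <= e by exact: expR_ge0.
have sl a : a \in s -> exists l : int, a = (l * g)%:~R.
  move=> /mapP[j _ ->]; have [gF _] := is_gcd_Fint n%:Z k.
  by have /dvdzP[l ->] := gF j%:Z; exists l.
have := @local_limit_of_pointwise R p s g m sg mu (2 * e) (2 * (72 * Cv) * r)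
  _ sg0 gm sl.
rewrite -(ltr0z R) => /(_ g0); rewrite !mulr_ge0 ?(ltW r0)// => /(_ isT isT) H.
apply: (le_trans (H _)).
  by move=> t tB; exact: (pointwise_bound m C10 key c0 ce cC cCv tB).
set B := pi * sg / g%:~R.
have B4 : B <= 4 * sg.
  rewrite ler_pdivrMr//; apply: (@le_trans _ _ (4 * sg * 1)).
    by rewrite mulr1 ler_pM2r//; lra.
  by rewrite ler_wpM2l// mulr_ge0// ltW.
have B2 : 2 * sg / n%:R <= B.
  apply: ler_pM; rewrite ?mulr_ge0 ?invr_ge0 ?(ltW sg0) ?(ltW n0)//.
    by rewrite ler_pM2r.
  by rewrite lef_pV2 ?posrE.
have B0 : 0 < B by rewrite divr_gt0// mulr_gt0//; lra.
have iB : 2 / B <= 2 * Cv * r.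
  rewrite ler_pdivrMr//.
  have h : n%:R / sg <= 2 * Cv * r by rewrite ler_pdivrMr.
  have h' : 2 <= n%:R / sg * B.
    rewrite mulrAC ler_pdivlMr//; move: B2; rewrite ler_pdivrMr//; lra.
  by apply: (le_trans h'); rewrite ler_wpM2r// ltW.
have Be := ler_wpM2r e_ge0 B4.
have se : 0 <= sg * e by rewrite mulr_ge0// ltW.
have Cr : 0 <= Cv * r by rewrite mulr_ge0 ?(ltW r0)//; lra.
have Cse : 0 <= Cv * (sg * e) by rewrite mulr_ge0//; lra.
by rewrite -/B; lra.
Qed.

End FixedParams.
End Main.

(** * The theorem *)

Theorem theorem5p1 (R : realType) (k : nat) (hk : (2 <= k)%N) :
  exists (n0 : nat) (C c : R), 0 < C /\ 0 < c /\
  forall (d : measure_display) (T : measurableType d) (P : probability T R)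
    (n : nat) (p : R) (X : nat -> {RV P >-> R}),
    (n0 <= n)%N ->
    n%:R^-1 <= p <= 2^-1 ->
    (forall j : nat, (1 <= j < n)%N -> is_bernoulli p (X j)) ->
    mutually_independent [set j : nat | (1 <= j < n)%N] X ->
    let S : T -> R :=
      fun t => \sum_(1 <= j < n) ratr (Fpoly n%:Z k).[j%:R] * X j t in
    let mu : R := fine ('E_P[S])%E in
    let sigma : R := Num.sqrt (fine ('V_P[S])%E) in
    let g : int := gcdF n%:Z k in
    0 < sigma ->
    forall m : int, (g %| m)%Z ->
    `| sigma / g%:~R * fine (P [set t | S t = m%:~R])
       - std_gauss ((m%:~R - mu) / sigma) |
    <= C * ((p * n%:R) `^ (- (6^-1)) + sigma * expR (- (c * (p * n%:R)))).
Proof.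
have [e0 [C1 [e00 [C10 key]]]] := @key_estimate R k hk.
pose Cv : R := 4 ^+ k.+2 * (8 * k)%:R ^+ (2 * k).
have Cv1 : 1 <= Cv.
  by rewrite /Cv mulr_ege1 ?exprn_ege1 ?ler1n ?muln_gt0 ?(ltn_trans _ hk).
have CC1 : 0 < (576 * C1)^-1 by rewrite invr_gt0; lra.
have CC2 : 0 < (36 * Cv)^-1 by rewrite invr_gt0; lra.
pose c : R := Num.min e0 (Num.min (576 * C1)^-1 (36 * Cv)^-1).
have c0 : 0 < c by rewrite /c !lt_min e00 CC1 CC2.
have ce : c <= e0 by rewrite /c ge_min lexx.
have cC : c <= (576 * C1)^-1 by rewrite /c !ge_min lexx orbT.
have cCv : c <= (36 * Cv)^-1 by rewrite /c !ge_min lexx !orbT.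
clearbody c.
exists (8 * k)%N, (12 * (72 * Cv) + 16 + 2 * Cv), c.
split; first by lra.
split=> // d T P n p X n8k /andP[pn p2] bX iX S mu sigma g sigma0 m gm.
have hV : n%:R ^+ (2 * k).+1 <= Cv * \sum_(a <- @Fcoef R k n) a ^+ 2 :> R.
  by rewrite /Fcoef big_map; exact: sum_Fint_sqr_lb.
pose a (j : nat) : R := (Fint n%:Z k j%:Z)%:~R.
have SE : S = fun t => \sum_(j <- index_iota 1 n) a j * X j t.
  apply/funext => t; apply: eq_bigr => j _; congr (_ * _).
  by rewrite /a -[j%:R]/(j%:Z%:~R) -FintE ratr_int.
have ur : uniq (index_iota 1 n) by exact: iota_uniq.
have rI j : j \in index_iota 1 n -> [set j : nat | (1 <= j < n)%N] j.
  by rewrite mem_index_iota.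
have muE : mu = p * \sum_(x <- @Fcoef R k n) x.
  by rewrite /mu SE (expectation_bernoulli_sum bX iX a ur rI).
have sigmaE : sigma = bern_sigma k n p.
  by rewrite /sigma SE (variance_bernoulli_sum bX iX a ur rI).
have := @bern_local_limit_bound R k hk n p n8k pn p2 _ Cv Cv1 hV e0 C1 c m C10
  (fun al => @key n al n8k) (ltW c0) ce cC cCv gm.
rewrite -sigmaE => /(_ sigma0).
rewrite -muE /g; congr (_ <= _); congr (`| _ * _ - _ |).
by rewrite SE (prob_bernoulli_sum bX iX a ur rI).
Qed.
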